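(* Suppose the following: (i) $\Gamma=(V_\Gamma, E_\Gamma)$ is a non-empty bipartite multigraph with at least one cycle. (ii) $D$ is the unsigned incidence matrix of $\Gamma$. (iii) $\tau(\Gamma)$ is the number of maximal forests in $\Gamma$. (iv) $\mathbb V = \operatorname{Ker}(D) \subseteq \mathbb{R}^{|E_\Gamma|}$ is a vector space of dimension $r$. (v) $\mathbf y\in\mathbb{R}^{|V_\Gamma|}$ is such that $D\mathbf x = \mathbf y$ is a consistent linear system. (vi) $K \subset \mathbb{R}^{|E_\Gamma|}$ is a compact convex set with non-empty interior $K^\circ$. (vii) $\phi : K \to \mathbb{R}$ is a continuous function, and the maximum of $\phi$ in $K$ subject to $D\mathbf x=\mathbf y$ is attained at a unique maximizer $\mathbf{\hat x} \in K^\circ$. (viii) $\phi$ is twice continuously differentiable in a neighbourhood of $\mathbf{\hat x}$, and $H$ is its Hessian matrix at $\mathbf{\hat x}$. (ix) $\psi : K_1 \to \mathbb{R}$ is a continuous function on some neighbourhood $K_1 \subseteq K$ of $\mathbf{\hat x}$ with $\psi(\mathbf{\hat x}) > 0$. (x) For each positive integer $n$, the set \[ \mathbb X_n = \left\{ \mathbf x\in K \cap \tfrac{1}{n} \mathbb{Z}^{|E_\Gamma|} : D\mathbf x = \mathbf y \right\} \] is non-empty, and there is a positive real number $c_n$ and a function $T_n : \mathbb X_n \to \mathbb{R}$ such that, as $n \to \infty$, \[ T_n(\mathbf x) = O\big( c_n e^{n\phi(\mathbf x)+o(n)}\big),\quad \mathbf x \in \mathbb X_n, \] and \[ T_n(\mathbf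 x) = c_n (\psi(\mathbf x) + o(1)) e^{n\phi(\mathbf x)}, \quad \mathbf x \in \mathbb X_n \cap K_1,\] uniformly for $\mathbf x$ in the indicated sets. Then, provided $\det(-H|_{\mathbb V} )\neq 0$, as $n \to \infty$, \[ \sum_{\mathbf x \in \mathbb X_n} T_n(\mathbf x) \sim \frac{\psi(\mathbf{\hat x})}{\tau(\Gamma)^{1/2} \det(-H|_{\mathbb V})^{1/2}} (2\pi n)^{r/2} c_n e^{n\phi(\mathbf{\hat x})}. \] Furthermore, in the case that $\Gamma$ is not bipartite, the same statement remains valid if $D$ is replaced throughout by the signed incidence matrix $\tilde D$ of $\Gamma$ (with respect to a fixed orientation of $E_\Gamma$).
   Context: Multigraphs are finite and may have multiple edges but no loops (two parallel edges form a cycle). Fix an arbitrary orientation of the edges of $\Gamma$. The signed incidence matrix is the $|V_\Gamma|\times|E_\Gamma|$ matrix $\tilde D=(\tilde D_{v,e})$ with $\tilde D_{v,e}=1$ if $v$ is the tail of $e$, $-1$ if $v$ is the head of $e$, and $0$ otherwise. The unsigned incidence matrix is $D=(|\tilde D_{v,e}|)$. A maximal forest of $\Gamma$ is an edge-maximal acyclic subgraph, i.e. a choice of a spanning tree in each connected component. For an $r$-dimensional subspace $\mathbb V\subseteq\mathbb R^N$ and a symmetric $N\times N$ matrix $H$, $\det(H|_{\mathbb V}) = \frac{\det U^THU}{\det U^TU}$, where $U$ is any $N\times r$ matrix whose columns form a basis of $\mathbb V$ (the value does not depend on the basis). *)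

(* Defs.v *)
From HB Require Import structures.
From mathcomp Require Import all_boot all_order all_algebra.
From mathcomp Require Import all_classical all_reals all_analysis.

Set Implicit Arguments.
Unset Strict Implicit.
Unset Printing Implicit Defensive.

Import Order.TTheory GRing.Theory Num.Theory.
Import numFieldNormedType.Exports.

Local Open Scope classical_set_scope.
Local Open Scope ring_scope.

Record multigraph := Multigraph {
  vertex : finType;
  edge : finType;
  ends : edge -> {set vertex};
  (* in particular there are no loops *)
  card_ends : forall e, #|ends e| = 2%N }.

Record orientation (G : multigraph) := Orientation {
  tail : edge G -> vertex G;
  head : edge G -> vertex G;
  ends_orient : forall e, ends e = [set tail e; head e]%SET }.

Section Graph.
Variable G : multigraph.

Definition bipartite :=
  exists A : {set vertex G}, forall e, #|(ends e :&: A)%SET| = 1%N.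

(* [:: (v_0, e_0); ...; (v_k, e_k)] stands for the closed walk
   v_0 e_0 v_1 e_1 ... v_k e_k v_0; two parallel edges form a cycle. *)
Definition is_cycle (s : seq (vertex G * edge G)) : bool :=
  [&& 1 < size s, uniq (map fst s), uniq (map snd s) &
      cycle (fun a b => ends a.2 == [set a.1; b.1]%SET) s]%N.

Definition has_cycle := exists s, is_cycle s.

(* A spanning subgraph is identified with its set of edges. *)
Definition acyclic (F : {set edge G}) :=
  ~ exists2 s, is_cycle s & {in s, forall a, a.2 \in F}.

Definition maximal_forest (F : {set edge G}) : bool :=
  maxset (fun F' => `[< acyclic F' >]) F.

Definition tau : nat := #|[set F | maximal_forest F]%SET|.

Variables (R : realType) (o : orientation G).

Definition signed_incidence : 'M[R]_(#|vertex G|, #|edge G|) :=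
  \matrix_(i, j)
    (let v := enum_val i in let e := enum_val j in
     if v == tail o e then 1 else if v == head o e then -1 else 0).

Definition unsigned_incidence : 'M[R]_(#|vertex G|, #|edge G|) :=
  map_mx (fun a => `|a|) signed_incidence.

End Graph.

Section RestrictedDeterminant.
Variables (R : realType) (N : nat).
Implicit Types (H : 'M[R]_N) (V : {vspace 'cV[R]_N}).

Definition cols_mx r (X : r.-tuple 'cV[R]_N) : 'M[R]_(N, r) :=
  \matrix_(i, j) tnth X j i 0.

(* The choice of the basis is immaterial: see det_restrE. *)
Definition det_restr H V : R :=
  let U := cols_mx (vbasis V) in
  \det (U^T *m H *m U) / \det (U^T *m U).

Lemma cols_mx_mul r (X : r.-tuple 'cV[R]_N) (c : 'cV[R]_r) :
  cols_mx X *m c = \sum_j c j 0 *: tnth X j.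
Proof.
apply/matrixP => i k; rewrite (ord1 k) mxE summxE; apply: eq_bigr => j _.
by rewrite !mxE mulrC.
Qed.

Lemma cols_mx_change r V (X Y : r.-tuple 'cV[R]_N) :
  basis_of V X -> basis_of V Y -> exists P, cols_mx Y = cols_mx X *m P.
Proof.
move=> bX bY; exists (\matrix_(i, j) coord X i (tnth Y j)).
apply/matrixP => i j; rewrite !mxE.
have YV : tnth Y j \in V by apply: (basis_mem bY); apply: mem_tnth.
rewrite {1}(coord_basis bX YV) summxE; apply: eq_bigr => k _.
by rewrite !mxE !(tnth_nth 0) mulrC.
Qed.

Lemma cols_mx_inj r V (X : r.-tuple 'cV[R]_N) (P Q : 'M[R]_(r, r)) :
  basis_of V X -> cols_mx X *m P = cols_mx X *m Q -> P = Q.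
Proof.
move=> /basis_free /freeP fX e; apply/matrixP => i j; apply/eqP.
rewrite -subr_eq0; apply/eqP.
suff /fX/(_ i) : \sum_k (P - Q) k j *: X`_k = 0 by rewrite !mxE.
transitivity (cols_mx X *m col j (P - Q)).
  rewrite cols_mx_mul; apply: eq_bigr => k _.
  by rewrite !mxE (tnth_nth 0).
by rewrite colE mulmxA mulmxBr e subrr mul0mx.
Qed.

Lemma det_restrE H V (X : (\dim V).-tuple 'cV[R]_N) : basis_of V X ->
  det_restr H V =
  \det ((cols_mx X)^T *m H *m cols_mx X) / \det ((cols_mx X)^T *m cols_mx X).
Proof.
move=> bX; have bV := vbasisP V.
have [P eP] := cols_mx_change bX bV; have [Q eQ] := cols_mx_change bV bX.
have : P *m Q = 1%:M.
  by apply: (cols_mx_inj bX); rewrite mulmxA -eP -eQ mulmx1.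
move=> /mulmx1_unit [uP _].
have dP : \det P * \det P != 0 by rewrite mulf_neq0 // -unitfE -unitmxE.
rewrite /det_restr eP trmx_mul !mulmxA.
rewrite -(mulmxA P^T) -(mulmxA P^T) -(mulmxA P^T _ (cols_mx X)).
set A := _ *m H *m _; set B := _ *m cols_mx X.
rewrite !det_mulmx det_tr !(mulrAC (\det P) _ (\det P)).
by rewrite -mulf_div divff // mul1r.
Qed.

End RestrictedDeterminant.

Section Calculus.
Variables (R : realType) (N : nat).
Implicit Types (f : 'cV[R]_N -> R) (x : 'cV[R]_N) (A : set 'cV[R]_N).

Definition partial f (i : 'I_N) x : R := 'D_(delta_mx i 0) f x.

Definition C1_on A f := forall (i : 'I_N) x, A x ->
  derivable f x (delta_mx i 0) /\ {for x, continuous (partial f i)}.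

Definition C2_near x f :=
  exists2 A, open_nbhs x A & C1_on A f /\ forall i, C1_on A (partial f i).

Definition hessian f x : 'M[R]_N :=
  \matrix_(i, j) partial (partial f j) i x.

End Calculus.

Section UniformLandau.
Variables (R : realType) (U : Type).
Implicit Types (X : nat -> set U) (f g : nat -> U -> R) (b : nat -> R).

Definition uniform_bigO X f g := exists C : R,
  \forall n \near \oo, forall x, X n x -> `|f n x| <= C * `|g n x|.

Definition uniform_littleo X f b := forall eps : R, 0 < eps ->
  \forall n \near \oo, forall x, X n x -> `|f n x| <= eps * `|b n|.

End UniformLandau.

Definition ker_cV (R : realType) (m N : nat) (D : 'M[R]_(m, N)) :
  {vspace 'cV[R]_N} := lker (linfun (mulmx D : 'cV[R]_N -> 'cV[R]_m)).

(* The points of K in (1/n) Z^N that satisfy D x = y; meaningful for n > 0. *)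
Definition lattice_points (R : realType) (m N : nat) (K : set 'cV[R]_N)
    (D : 'M[R]_(m, N)) (y : 'cV[R]_m) (n : nat) : set 'cV[R]_N :=
  [set x | [/\ K x,
               exists z : 'cV[int]_N, x = n%:R^-1 *: map_mx intr z
             & D *m x = y]].

(* Main.v *)
(* On the affine space [D x = y] the sum is a Laplace-type sum over a translate
   of the lattice [(1/n) (ker D /\ Z^E)].

   The fundamental cycles of a maximal forest give a lattice basis [B] of the
   integer kernel: cycles give kernel vectors with entries [1], [-1] on the cycle,
   and a nonzero kernel vector contains a cycle in its support (follow a
   non-backtracking walk).  By Cauchy-Binet [det (B^T B)] is the sum of the squares
   of the maximal minors of [B]; a minor is [1] or [-1] when the complement of its
   rows is a maximal forest, and [0] otherwise, so [det (B^T B) = tau G].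

   By Taylor's formula the summand behaves near the maximizer like
   [psi(xhat) exp (- n q)], with [q] half the quadratic form [- H] in the
   coordinates given by [B]; compactness makes the other terms negligible.

   The remaining lattice sum of a Gaussian is computed without any
   multidimensional integral: completing the square in the first coordinate leaves
   a one-dimensional sum over a shifted lattice, which converges to the Gaussian
   integral uniformly in the shift, and one concludes by induction on the
   dimension. *)
Require Import Defs.
From HB Require Import structures.
From mathcomp Require Import all_boot all_order all_algebra all_fingroup.
From mathcomp Require Import all_classical all_reals all_analysis.
From mathcomp Require Import measurable_realfun ring lra zify.

Set Implicit Arguments.
Unset Strict Implicit.
Unset Printing Implicit Defensive.

Import Order.TTheory GRing.Theory Num.Theory.
Import numFieldNormedType.Exports.

Local Open Scope classical_set_scope.
Local Open Scope ring_scope.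


(** * The Cauchy-Binet formula *)

(** Negating the rows of one side of a bipartition turns the unsigned incidence matrix into a signed
    one, so both cases are treated together through integers [d v e] and vertex signs [sg v].

    A kernel vector is determined by its entries outside a maximal forest, and fundamental cycles
    are dual to these coordinates. Hence integer kernel vectors have integer coordinates in [B], and
    two such bases differ by an invertible integer matrix, which is why the nonzero minors are
    units.

    In the coordinates of [B] the points of [X n] lie on a translate of the lattice of step [1/n]
    whose position relative to the maximizer is arbitrary and changes with [n]: this forces
    uniformity in the shift. Dilating by [sqrt n] makes the step [1 / sqrt n] and produces the power
    of [n].

    Far from the maximizer the terms are known only up to [exp (o(n))]. The exponent is therefore
    bounded on all of [K] by a negative multiple of the quadratic form; part of this decay absorbs
    [o(n)], and what is left is again a Gaussian sum.

    With [A] the matrix of [- H] in these coordinates, [det A] is [tau G] times the restricted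
    determinant, whence the factor [tau G] in the formula. *)

Lemma det_mulmx_sum_rowsub (R : comNzRingType) n N
    (A : 'M[R]_(n, N)) (B : 'M[R]_(N, n)) :
  \det (A *m B) =
  \sum_(f : {ffun 'I_n -> 'I_N}) (\prod_i A i (f i)) * \det (rowsub f B).
Proof.
rewrite /determinant.
under eq_bigr => s _.
  under eq_bigr do rewrite mxE.
  rewrite bigA_distr_bigA /= mulr_sumr.
  over.
rewrite exchange_big; apply: eq_bigr => f _.
rewrite mulr_sumr; apply: eq_bigr => s _.
rewrite big_split /= mulrCA; congr (_ * (_ * _)).
by apply: eq_bigr => i _; rewrite mxE.
Qed.

Lemma det_rowsub_perm (R : comNzRingType) n N (f : 'I_n -> 'I_N)
    (s : 'S_n) (B : 'M[R]_(N, n)) :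
  \det (rowsub (f \o s) B) = (-1) ^+ s * \det (rowsub f B).
Proof.
have -> : rowsub (f \o s) B = row_perm s (rowsub f B).
  by apply/matrixP => i j; rewrite !mxE.
by rewrite row_permE det_mulmx det_perm.
Qed.

Lemma rowsub_mulmx (R : pzSemiRingType) m n p q (g : 'I_q -> 'I_m)
  (X : 'M[R]_(m, n)) (Y : 'M[R]_(n, p)) : rowsub g (X *m Y) = rowsub g X *m Y.
Proof.
by apply/matrixP => i j; rewrite !mxE; apply: eq_bigr => k _; rewrite !mxE.
Qed.

(* Cauchy-Binet, summed over all maps instead of over increasing ones, whence
   the factorial. *)
Lemma Cauchy_Binet_ffun (R : comNzRingType) n N
    (A : 'M[R]_(n, N)) (B : 'M[R]_(N, n)) :
  \det (A *m B) *+ n`! =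
  \sum_(f : {ffun 'I_n -> 'I_N}) \det (colsub f A) * \det (rowsub f B).
Proof.
(* Every permutation [s] gives an expression of the same determinant, by reindexing [f] as [f \o s].
   Adding up the [n!] expressions completes the products of entries of [A] into minors. *)
have detE (s : 'S_n) : \det (A *m B) = \sum_(f : {ffun 'I_n -> 'I_N})
    ((-1) ^+ s * \prod_i A i (f (s i))) * \det (rowsub f B).
  rewrite det_mulmx_sum_rowsub.
  have /(reindex _) -> : {on predT, bijective
      (fun f : {ffun 'I_n -> 'I_N} => [ffun i => f (s i)])}.
    exists (fun f : {ffun 'I_n -> 'I_N} => [ffun i => f (s^-1 i)%g]) => f _;
      by apply/ffunP => i; rewrite !ffunE ?permKV ?permK.
  apply: eq_bigr => f _.
  rewrite (eq_bigr (fun i => A i (f (s i)))); last by move=> i _; rewrite ffunE.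
  rewrite -(mulrC (\prod_i _)) -mulrA -det_rowsub_perm; congr (_ * \det _).
  by apply/matrixP => i j; rewrite !mxE ffunE.
rewrite -card_Sn -sumr_const.
rewrite (eq_bigr _ (fun s _ => detE s)) /=.
rewrite (eq_bigl predT); last by move=> s; rewrite inE.
rewrite exchange_big; apply: eq_bigr => f _; rewrite -mulr_suml; congr (_ * _).
by apply: eq_bigr => s _; congr (_ * _); apply: eq_bigr => i _; rewrite mxE.
Qed.

(** * The lattice of integer cycles *)

Lemma uniq_map_inj_in (T U : eqType) (f : T -> U) (s : seq T) :
  uniq (map f s) -> {in s &, injective f}.
Proof.
elim: s => [//|c s IH] /= /andP [cs us] a b; rewrite !inE.
move=> /orP [/eqP ->|as_] /orP [/eqP ->|bs] // e.
- by move: cs; rewrite e map_f.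
- by move: cs; rewrite -e map_f.
- exact: IH us _ _ as_ bs e.
Qed.

Section CycleSpace.
Variables (G : multigraph) (d : vertex G -> edge G -> int) (sg : vertex G -> int).
Hypothesis d_out : forall v e, v \notin ends e -> d v e = 0.
Hypothesis d_in : forall v e, v \in ends e -> d v e * d v e = 1.
Hypothesis sg_sq : forall v, sg v * sg v = 1.
Hypothesis d_sg : forall u w e, u != w -> ends e = [set u; w]%SET ->
  sg u * d u e + sg w * d w e = 0.

Lemma other_end (v : vertex G) e : v \in ends e ->
  exists2 w, w != v & ends e = [set v; w]%SET.
Proof.
move=> ve; have /eqP/cards2P [a [b [ab eab]]] := card_ends e.
move: ve; rewrite eab !inE => /orP[] /eqP ->.
  by exists b => //; rewrite eq_sym.
by exists a => //; rewrite finset.setUC.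
Qed.

Section KernelToCycle.
Variables (R : realDomainType) (x : edge G -> R).
Hypothesis kerx : forall v, \sum_e (d v e)%:~R * x e = 0.

Let good (p : vertex G * edge G) := p.1 \in ends p.2 /\ x p.2 != 0.

(** Otherwise [e] would be the only edge of the support at its far end [w], and the equation at [w]
    would read [d w e * x e = 0] with both factors nonzero. *)
Lemma kernel_step p : good p -> exists p', [/\ good p',
  ends p.2 = [set p.1; p'.1]%SET, p'.1 != p.1 & p'.2 != p.2].
Proof.
case: p => v e [/= ve xe]; have [w wv ew] := other_end ve.
have we : w \in ends e by rewrite ew !inE eqxx orbT.
have [[e' [e'e xe' we']]|nex] :=
    pselect (exists e', [/\ e' != e, x e' != 0 & w \in ends e']).
  by exists (w, e').
have := kerx w; rewrite (bigD1 e) //= big1 ?addr0.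
  move=> /eqP; rewrite mulf_eq0 (negPf xe) orbF intr_eq0 => /eqP dw.
  by have := d_in we; rewrite dw.
move=> e' e'e; case: (boolP (w \in ends e')) => [we'|/d_out ->]; last first.
  by rewrite mul0r.
suff /eqP -> : x e' == 0 by rewrite mulr0.
by apply/negPn/negP => xe'; apply: nex; exists e'.
Qed.

(** By finiteness the walk revisits a vertex. If [j] is the first time this happens and [i] the time
    of the earlier visit, the walk between [i] and [j] is a cycle. *)
Lemma kernel_support_cycle e0 : x e0 != 0 ->
  exists2 s, is_cycle s & {in s, forall a, x a.2 != 0}.
Proof.
move=> xe0.
have /boolp.choice [nxt nxtP] : forall p, exists p', good p -> [/\ good p',
    ends p.2 = [set p.1; p'.1]%SET, p'.1 != p.1 & p'.2 != p.2].
  move=> p; have [gp|ngp] := pselect (good p); last by exists p.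
  by have [p' h] := kernel_step gp; exists p'.
have [v0 v0e0] : exists v0, v0 \in ends e0.
  by apply/set0Pn; rewrite -card_gt0 card_ends.
pose P k := iter k nxt (v0, e0).
have gP k : good (P k).
  by elim: k => [//|k IH] /=; have [] := nxtP _ IH.
have stepP k := nxtP _ (gP k); rewrite -/(P _) in stepP.
have rep : exists j, [exists i : 'I_j, (P i).1 == (P j).1].
  apply: contrapT => norep.
  have : (#|'I_(#|vertex G|.+1)| <= #|vertex G|)%N.
    apply: (@leq_card _ _ (fun k : 'I_(#|vertex G|.+1) => (P k).1)).
    move=> a b /= eab; apply/val_inj; apply: contrapT => /= /eqP.
    rewrite neq_ltn => /orP[lt|lt]; apply: norep; [exists b|exists a];
      apply/existsP; by [exists (Ordinal lt); rewrite /= eab].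
  by rewrite card_ord ltnn.
case: (ex_minnP rep) => j /existsP [i /eqP eij] minj.
have dis a b : (a < b < j)%N -> (P a).1 != (P b).1.
  move=> /andP [ab bj]; apply/negP => eab.
  have : (j <= b)%N by apply: minj; apply/existsP; exists (Ordinal ab).
  by rewrite leqNgt bj.
have disE a b : (a < j)%N -> (b < j)%N -> (P a).1 = (P b).1 -> a = b.
  move=> aj bj eab; apply/eqP; rewrite eqn_leq.
  apply/andP; split; rewrite leqNgt; apply/negP => lt.
    by have := dis b a; rewrite lt aj eab eqxx => /(_ isT).
  by have := dis a b; rewrite lt bj eab eqxx => /(_ isT).
(* If the edges at times [a < b] agree, the vertex at time [b] is an end of the edge at time [a],
   hence the vertex at time [a] or [a.+1]. The former contradicts [dis]; the latter gives
   [b = a.+1], which would be backtracking. *)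
have edis a b : (a < b < j)%N -> (P a).2 != (P b).2.
  move=> /andP [ab bj]; apply/negP => /eqP eab.
  have [_ na _ _] := stepP a.
  have : (P b).1 \in ends (P a).2 by rewrite eab; have [] := gP b.
  rewrite na !inE => /orP[] /eqP h.
    by have := dis a b; rewrite ab bj h eqxx => /(_ isT).
  have bE : b = a.+1 by apply: disE => //; exact: leq_ltn_trans ab bj.
  have [_ _ _] := stepP a; by rewrite -[nxt _]/(P a.+1) -bE eab eqxx.
have edisE a b : (a < j)%N -> (b < j)%N -> (P a).2 = (P b).2 -> a = b.
  move=> aj bj eab; apply/eqP; rewrite eqn_leq.
  apply/andP; split; rewrite leqNgt; apply/negP => lt.
    by have := edis b a; rewrite lt aj eab eqxx => /(_ isT).
  by have := edis a b; rewrite lt bj eab eqxx => /(_ isT).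
(* A cycle has length at least 2; here this holds because consecutive vertices of the walk
   differ. *)
have [m jE] : exists m, j = (i + m.+2)%N.
  have ij := ltn_ord i; have : j != i.+1.
    apply/eqP => jE; have [_ _ + _] := stepP i.
    by rewrite -[nxt _]/(P i.+1) -jE -eij eqxx.
  by move=> ji; exists (j - i.+2)%N; lia.
have inS k : k \in iota i m.+2 -> (k < j)%N by rewrite mem_iota => /andP[]; lia.
exists [seq P k | k <- iota i m.+2]; last first.
  by move=> a /mapP [k _ ->]; have [] := gP k.
apply/and4P; split.
- by rewrite size_map size_iota.
- rewrite -map_comp map_inj_in_uniq ?iota_uniq // => a b /inS aj /inS bj.
  exact: disE.
- rewrite -map_comp map_inj_in_uniq ?iota_uniq // => a b /inS aj /inS bj.
  exact: edisE.
rewrite -[map _ _]/(P i :: map P (iota i.+1 m.+1)) /path.cycle rcons_path.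
have pathP k n : path (fun a b => ends a.2 == [set a.1; b.1]%SET) (P k)
    (map P (iota k.+1 n)).
  elim: n k => [//|n IH] k; have [_ eb _ _] := stepP k.
  by apply/andP; split; [apply/eqP; exact: eb | exact: IH].
have lastP k n : last (P k) (map P (iota k.+1 n)) = P (k + n)%N.
  elim: n k => [|n IH] k; first by rewrite addn0.
  by rewrite addnS -addSn; exact: IH.
rewrite pathP lastP /=; have [_ + _ _] := stepP (i + m.+1)%N.
rewrite -[nxt _]/(P (i + m.+1).+1) (_ : (i + m.+1).+1 = j) -?eij => [->//|].
exact: esym (etrans jE (addnS _ _)).
Qed.

End KernelToCycle.

(** A step that leaves [u] through [e] towards [w] gets the weight [sg u * d u e]. Multiplied by
    [sg v], its contribution to the equation at [v] is [(v == u) - (v == w)], and these differences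
    telescope around the closed walk. *)
Lemma cycle_kernel s : is_cycle s -> exists z : edge G -> int,
  [/\ forall v, \sum_e d v e * z e = 0,
      forall e, e \notin map snd s -> z e = 0 &
      forall e, e \in map snd s -> z e * z e = 1].
Proof.
move=> /and4P [s1 us1 us2 cs].
have ends_s a : a \in s -> a.1 \in ends a.2.
  move=> /(next_cycle cs) /eqP ->; by rewrite !inE eqxx.
pose w (a : vertex G * edge G) := sg a.1 * d a.1 a.2.
(* The edges of a cycle are distinct, so each of these sums has at most one term; written as a sum,
   it can be exchanged with the sum over the edges. *)
exists (fun e => \sum_(a <- s | a.2 == e) w a); split.
- move=> v; apply: (@mulfI _ (sg v)).
    by apply/eqP => sv; have := sg_sq v; rewrite sv.
  under eq_bigr do rewrite mulr_sumr.
  rewrite mulr0 (exchange_big_dep predT) //= mulr_sumr.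
  rewrite (eq_bigr (fun a => sg v * d v a.2 * w a)); last first.
    by move=> a _; rewrite (big_pred1 a.2) ?mulrA // => e; rewrite eq_sym.
  case: s cs s1 {us1 us2 ends_s} => [//|p0 s] cs s1.
  pose rl := (fun a b : vertex G * edge G => ends a.2 == [set a.1; b.1]%SET).
  have telescope p t : path rl p t ->
      \sum_(a <- belast p t) sg v * d v a.2 * w a =
      (v == p.1)%:R - (v == (last p t).1)%:R :> int.
    elim: t p => [|b t IH] p /=; first by rewrite big_nil subrr.
    move=> /andP [/eqP eb /IH]; rewrite big_cons => ->.
    rewrite addrA; congr (_ - _).
    suff -> : sg v * d v p.2 * w p = (v == p.1)%:R - (v == b.1)%:R.
      by rewrite subrK.
    have pb : p.1 != b.1.
      by apply/eqP => h; have := card_ends p.2; rewrite eb h finset.setUid cards1.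
    have pin : p.1 \in ends p.2 by rewrite eb !inE eqxx.
    have dd : sg p.1 * d p.1 p.2 * (sg p.1 * d p.1 p.2) = 1.
      by rewrite mulrACA sg_sq d_in.
    rewrite /w; have [->|vp] := eqVneq v p.1.
      by rewrite dd (negPf pb) subr0.
    have [->|vb] := eqVneq v b.1.
      have /eqP := d_sg pb eb; rewrite addrC addr_eq0 => /eqP ->.
      by rewrite mulNr dd sub0r.
    by rewrite d_out ?mulr0 ?mul0r ?subrr // eb !inE negb_or vp vb.
  have := telescope p0 (rcons s p0) cs.
  by rewrite belast_rcons last_rcons subrr.
- move=> e nes; rewrite big_seq_cond big1 // => a /andP [as_ /eqP ae].
  by move: nes; rewrite -ae map_f.
- move=> e /mapP [a as_ ->].
  rewrite big_mkcond (bigD1_seq a) //=; last exact: map_uniq us1.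
  rewrite eqxx -big_mkcondr big_seq_cond big1 ?addr0.
    by rewrite /w mulrACA sg_sq d_in // ends_s.
  move=> b /andP [bs /andP [nab /eqP ab]]; case/negP: nab; apply/eqP.
  exact: uniq_map_inj_in us2 _ _ bs as_ ab.
Qed.

Lemma acyclic_kernel0 (R : realDomainType) (F : {set edge G}) (x : edge G -> R) :
  acyclic F -> (forall v, \sum_e (d v e)%:~R * x e = 0) ->
  (forall e, e \notin F -> x e = 0) -> forall e, x e = 0.
Proof.
move=> acF kx x0 e; apply/eqP/negPn/negP => /(kernel_support_cycle kx) [s cs xs].
apply: acF; exists s => // a /xs xa.
by apply/negPn/negP => /x0 a0; rewrite a0 eqxx in xa.
Qed.

Lemma maximal_forestP (F : {set edge G}) : maximal_forest F ->
  acyclic F /\ forall F', acyclic F' -> F \subset F' -> F' = F.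
Proof.
move=> /maxsetP [/asboolP acF mF]; split=> // F' acF' FF'.
by apply: mF => //; apply/asboolP.
Qed.

Lemma fundamental_cycle (F : {set edge G}) e0 : maximal_forest F -> e0 \notin F ->
  exists z : edge G -> int, [/\ forall v, \sum_e d v e * z e = 0, z e0 = 1 &
    forall e, e \notin F -> e != e0 -> z e = 0].
Proof.
move=> /maximal_forestP [acF mF] e0F.
have [s cs sF] : exists2 s, is_cycle s & {in s, forall a, a.2 \in e0 |: F}%SET.
  apply: contrapT => /mF; rewrite finset.subsetUr => /(_ isT) h.
  by move: e0F; rewrite -h finset.setU11.
have e0s : e0 \in map snd s.
  apply/negPn/negP => e0s; apply: acF; exists s => // a as_.
  have := sF _ as_; rewrite !inE => /orP [/eqP ae|//].
  by move: e0s; rewrite -ae map_f.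
have [z [kz z0 z1]] := cycle_kernel cs.
(* The cycle passes through [e0] because [F] is acyclic, so [z e0] is a sign, and multiplying by it
   normalises the entry at [e0] to 1. *)
exists (fun e => z e0 * z e); split; last 1 first.
- move=> e eF ee0; rewrite (z0 e) ?mulr0 //; apply/negP => /mapP [a as_ ea].
  by have := sF _ as_; rewrite -ea !inE (negPf eF) (negPf ee0).
- move=> v; transitivity (z e0 * \sum_e d v e * z e); last by rewrite kz mulr0.
  rewrite mulr_sumr; by apply: eq_bigr => e _; rewrite mulrCA.
- exact: z1.
Qed.

Lemma exists_maximal_forest (F : {set edge G}) : acyclic F ->
  exists2 F', maximal_forest F' & F \subset F'.
Proof.
move=> /asboolP acF.
have [F' mF' FF'] := @maxset_exists _ (fun F' => `[< acyclic F' >]) F acF.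
by exists F'.
Qed.

Lemma acyclic_set0 : @acyclic G finset.set0.
Proof. by move=> [[//|a s] _ h]; have := h a (mem_head _ _); rewrite inE. Qed.

End CycleSpace.

(** * Integer kernels with dual coordinates *)

Section KernelLattice.
Variables (R : realType) (m N : nat) (D : 'M[R]_(m, N)) (Q : pred {set 'I_N}).
Let V := ker_cV D.

Lemma mem_ker_cV x : (x \in V) = (D *m x == 0).
Proof. by rewrite memv_ker lfunE. Qed.

Hypothesis Q_inj : forall S, Q S -> forall x : 'cV[R]_N, D *m x = 0 ->
  (forall i, i \in S -> x i 0 = 0) -> x = 0.
Hypothesis Q_dual : forall S, Q S -> forall i, i \in S -> exists z : 'cV[int]_N,
  [/\ D *m map_mx intr z = 0, z i 0 = 1 &
      forall j, j \in S -> j != i -> z j 0 = 0].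

(** [Q] stands for the family of complements of maximal forests. The vectors dual to the elements of
    [S] become the columns of [B], so that the coordinates of a kernel vector in [B] are simply its
    entries on [S]. *)
Lemma dual_basis n (f : 'I_n -> 'I_N) (S : {set 'I_N}) : Q S -> injective f ->
  (forall i, (i \in S) = (i \in codom f)) ->
  exists2 B : 'M[int]_(N, n), D *m map_mx intr B = 0 & rowsub f B = 1%:M.
Proof.
move=> QS injf Sf.
have /boolp.choice [z zP] : forall j, exists z : 'cV[int]_N,
    [/\ D *m map_mx intr z = 0, z (f j) 0 = 1 &
      forall i, i != j -> z (f i) 0 = 0].
  move=> j; have fjS : f j \in S by rewrite Sf codom_f.
  have [z [Dz zj z0]] := Q_dual QS fjS; exists z; split=> // i ij.
  by apply: z0; rewrite ?Sf ?codom_f // (inj_eq injf).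
exists (\matrix_(i, j) z j i 0).
  apply/matrixP => i j; have [/matrixP /(_ i 0) h _ _] := zP j.
  by rewrite !mxE in h *; rewrite -[RHS]h; apply: eq_bigr => k _; rewrite !mxE.
apply/matrixP => i j; rewrite !mxE; have [_ zj z0] := zP j.
by have [->|ij] := eqVneq i j; rewrite ?zj ?z0.
Qed.

Section Basis.
Variables (n : nat) (f : 'I_n -> 'I_N) (S : {set 'I_N}).
Hypothesis QS : Q S.
Hypothesis Sf : forall i, (i \in S) = (i \in codom f).
Variable (B : 'M[int]_(N, n)).
Hypotheses (DB : D *m map_mx intr B = 0) (fB : rowsub f B = 1%:M).


(** The two sides differ by a kernel vector that vanishes on [S], since the rows of [B] indexed by
    [S] form the identity. *)
Lemma kernel_coord (x : 'cV[R]_N) : D *m x = 0 ->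
  x = map_mx intr B *m rowsub f x.
Proof.
move=> Dx; apply/eqP; rewrite -subr_eq0; apply/eqP/(Q_inj QS).
  by rewrite mulmxBr Dx mulmxA DB mul0mx subrr.
move=> i; rewrite Sf => /codomP [j ->].
have : rowsub f (x - map_mx intr B *m rowsub f x) = 0.
  rewrite linearB /= rowsub_mulmx -map_mxsub fB map_mx1 mul1mx subrr //.
by move/matrixP => /(_ j 0); rewrite !mxE.
Qed.

(** The coordinates of [z] are entries of [z], hence integers: the columns of [B] generate the
    lattice of integer points, not only the real kernel. *)
Lemma int_kernel_coord (z : 'cV[int]_N) : D *m map_mx intr z = 0 ->
  z = B *m rowsub f z.
Proof.
move=> Dz; have := kernel_coord Dz; rewrite -map_mxsub -map_mxM => h.
apply/matrixP => i j; apply: (@intr_inj R).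
by have /matrixP /(_ i j) := h; rewrite !mxE.
Qed.

Lemma kernel_coord_inj (x : 'cV[R]_n) : rowsub f (map_mx intr B *m x) = x.
Proof. by rewrite rowsub_mulmx -map_mxsub fB map_mx1 mul1mx. Qed.

Lemma dim_kernel : \dim V = n.
Proof.
pose g := linfun (mulmx (map_mx intr B) : 'cV[R]_n -> 'cV[R]_N).
have gE x : g x = map_mx intr B *m x by rewrite lfunE.
have -> : V = limg g.
  apply/vspaceP => x; rewrite mem_ker_cV; apply/eqP/memv_imgP.
    by move=> /kernel_coord h; exists (rowsub f x); rewrite ?memvf ?gE.
  by move=> [t _ ->]; rewrite gE mulmxA DB mul0mx.
rewrite limg_dim_eq ?dimvf /dim /= ?muln1 //.
rewrite capfv; apply/eqP; rewrite -subv0; apply/subvP => x.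
rewrite memv_ker memv0 gE => /eqP h; apply/eqP.
by rewrite -(kernel_coord_inj x) h; apply/matrixP => i j; rewrite !mxE.
Qed.

End Basis.

Lemma card_codom_set n (f : 'I_n -> 'I_N) : injective f ->
  #|[set i in codom f]%SET| = n.
Proof. by move=> injf; rewrite cardsE card_codom // card_ord. Qed.

Lemma dim_good S : Q S -> \dim V = #|S|.
Proof.
move=> QS; pose f (i : 'I_#|S|) := enum_val i.
have injf : injective f by apply: enum_val_inj.
have Sf i : (i \in S) = (i \in codom f).
  apply/idP/codomP => [iS|[j ->]]; last exact: enum_valP.
  by exists (enum_rank_in iS i); rewrite /f enum_rankK_in.
have [B DB fB] := dual_basis QS injf Sf.
exact: (dim_kernel QS Sf DB fB).
Qed.

Hypothesis Q_ex : exists S, Q S.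
Hypothesis Q_out : forall S : {set 'I_N}, #|S| = \dim V -> ~~ Q S ->
  exists x : 'cV[R]_N, [/\ x != 0, D *m x = 0 & forall i, i \in S -> x i 0 = 0].

Lemma kernel_lattice_basis n : \dim V = n -> exists B : 'M[int]_(N, n),
  [/\ D *m map_mx intr B = 0,
      forall x : 'cV[R]_N, D *m x = 0 -> exists t, x = map_mx intr B *m t,
      forall z : 'cV[int]_N, D *m map_mx intr z = 0 -> exists k, z = B *m k,
      forall t : 'cV[R]_n, map_mx intr B *m t = 0 -> t = 0 &
      \det (B^T *m B) = #|[set S | Q S]%SET|%:Z].
Proof.
move=> dimV; have [S0 QS0] := Q_ex.
have exf S : Q S -> exists f : 'I_n -> 'I_N, injective f /\
    forall i, (i \in S) = (i \in codom f).
  move=> QS; have := dim_good QS; rewrite dimV => ->.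
  exists (fun i => enum_val i); split; first exact: enum_val_inj.
  move=> i; apply/idP/codomP => [iS|[j ->]]; last exact: enum_valP.
  by exists (enum_rank_in iS i); rewrite enum_rankK_in.
have [f0 [injf0 Sf0]] := exf _ QS0.
have [B DB fB] := dual_basis QS0 injf0 Sf0.
have cB := kernel_coord QS0 Sf0 DB fB.
have icB := int_kernel_coord QS0 Sf0 DB fB.
have Binj (t : 'cV[R]_n) : map_mx intr B *m t = 0 -> t = 0.
  move=> Bt; rewrite -(kernel_coord_inj fB t) Bt.
  by apply/matrixP => i j; rewrite !mxE.
exists B; split=> //.
- by move=> x /cB h; exists (rowsub f0 x).
- by move=> z /icB h; exists (rowsub f0 z).
(* [C] is the basis dual to the rows chosen by [f]. As [C = B *m rowsub f0 C], taking these rows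
   shows that the minor has an integer inverse. *)
have detQ (f : 'I_n -> 'I_N) : injective f -> Q [set i in codom f]%SET ->
    \det (rowsub f B) ^+ 2 = 1.
  move=> injf Qf.
  have Sf i : (i \in [set i in codom f]%SET) = (i \in codom f) by rewrite inE.
  have [C DC fC] := dual_basis Qf injf Sf.
  have CE : C = B *m rowsub f0 C.
    apply/matrixP => i j.
    have Dj : D *m map_mx intr (col j C) = 0.
      by rewrite map_col colE mulmxA DC mul0mx.
    have /matrixP /(_ i 0) := icB _ Dj.
    rewrite !mxE => ->; apply: eq_bigr => k _; congr (_ * _).
    by rewrite !mxE.
  have : rowsub f B *m rowsub f0 C = 1%:M by rewrite -rowsub_mulmx -CE.
  move=> /(congr1 determinant); rewrite det_mulmx det1.
  move: (\det (rowsub f B)) (\det (rowsub f0 C)) => a b ab.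
  have : a \is a GRing.unit by apply/unitrP; exists b; rewrite [b * a]mulrC ab.
  by case/orP => /eqP ->.
have det0 (f : 'I_n -> 'I_N) : ~~ (injectiveb f && Q [set i in codom f]%SET) ->
    \det (rowsub f B) = 0.
  move=> /nandP [/injectivePn [i [j ij fij]]|nQ].
    apply: (determinant_alternate ij) => k; by rewrite !mxE fij.
  have [injf|] := boolP (injectiveb f); last first.
    move=> /injectivePn [i [j ij fij]].
    apply: (determinant_alternate ij) => k; by rewrite !mxE fij.
  have cS : #|[set i in codom f]%SET| = \dim V.
    by rewrite dimV card_codom_set //; apply/injectiveP.
  (* The coordinates in [B] of a nonzero kernel vector that vanishes on the chosen rows form a
     nonzero vector killed by the square submatrix. *)
  have [x [x0 Dx xS]] := Q_out cS nQ.
  apply/eqP; rewrite -(intr_eq0 R) -det_map_mx -det_tr; apply/det0P.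
  have xE := cB _ Dx; set t := rowsub f0 x in xE.
  exists t^T.
    apply: contra x0 => /eqP /(congr1 trmx); rewrite trmxK xE => ->.
    by rewrite trmx0 mulmx0.
  rewrite -trmx_mul map_mxsub -rowsub_mulmx -xE.
  by apply/matrixP => i j; rewrite !mxE (ord1 i) xS // inE codom_f.
have n0 : (n`!)%:Z != 0 by rewrite -lt0n fact_gt0.
apply: (mulIf n0); rewrite -[(n`!)%:Z]natz mulr_natr Cauchy_Binet_ffun.
rewrite natz -PoszM.
pose good (g : {ffun 'I_n -> 'I_N}) := injectiveb g && Q [set i in codom g]%SET.
transitivity (\sum_(g | good g) 1 : int).
  rewrite [RHS]big_mkcond; apply: eq_bigr => g _.
  have -> : colsub g B^T = (rowsub g B)^T by apply/matrixP => i j; rewrite !mxE.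
  rewrite det_tr -expr2; case: ifP => [/andP [/injectiveP injg Qg]|/negbT ng].
    exact: detQ.
  by rewrite det0 ?expr0n.
(* Each set in [Q] has [n] elements and is the image of exactly [n!] injections, which cancels the
   factorial. *)
rewrite sumr_const natz; congr Posz.
rewrite -sum1_card (partition_big (fun g : {ffun 'I_n -> 'I_N} =>
  [set i in codom g]%SET) Q) /=; last by move=> g /andP [].
rewrite -sum_nat_const.
rewrite [RHS](eq_bigl Q); last by move=> S; rewrite inE.
apply: eq_bigr => S QS; rewrite sum1_card.
have cS : #|S| = n by rewrite -(dim_good QS).
have := @card_inj_ffuns_on 'I_n 'I_N (mem S).
rewrite cS card_ord ffactnn => <-; rewrite -sum1_card -[RHS]sum1_card.
apply: eq_bigl => g; rewrite inE /good unfold_in.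
have [injg|/negPf ng] := boolP (injectiveb g); last first.
  by rewrite andbF unfold_in ng.
rewrite andbT unfold_in injg /=; apply/andP/ffun_onP.
  by move=> [_ /eqP <-] i; rewrite inE codom_f.
move=> gS; have e : [set i in codom g]%SET = S.
  apply/eqP; rewrite eqEcard cS card_codom_set ?leqnn ?andbT; last exact/injectiveP.
  by apply/fintype.subsetP => i; rewrite inE => /codomP [j ->].
by rewrite e eqxx.
Qed.

End KernelLattice.

(** * The cycle lattice of a graph *)

Section GraphLattice.
Variables (R : realType) (G : multigraph) (D : 'M[R]_(#|vertex G|, #|edge G|)).
Variables (d : vertex G -> edge G -> int) (sg : vertex G -> int).
Hypothesis d_out : forall v e, v \notin ends e -> d v e = 0.
Hypothesis d_in : forall v e, v \in ends e -> d v e * d v e = 1.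
Hypothesis sg_sq : forall v, sg v * sg v = 1.
Hypothesis d_sg : forall u w e, u != w -> ends e = [set u; w]%SET ->
  sg u * d u e + sg w * d w e = 0.
Hypothesis DE : forall i j, D i j = (d (enum_val i) (enum_val j))%:~R.

Lemma kernelE (x : 'cV[R]_#|edge G|) : D *m x = 0 <->
  forall v, \sum_e (d v e)%:~R * x (enum_rank e) 0 = 0.
Proof.
have E i : (D *m x) i 0 =
    \sum_e (d (enum_val i) e)%:~R * x (enum_rank e) 0.
  rewrite mxE (reindex (@enum_val _ (edge G))) /=; last first.
    by exists enum_rank => e _; rewrite ?enum_valK ?enum_rankK.
  by apply: eq_bigr => j _; rewrite DE enum_valK.
split=> [Dx v|h].
  by rewrite -[v]enum_rankK -E Dx mxE.
by apply/matrixP => i j; rewrite (ord1 j) E h mxE.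
Qed.

(** Complements are taken because it is the entries outside a forest that serve as coordinates on
    the kernel. *)
Definition coforest (S : {set 'I_#|edge G|}) : bool :=
  maximal_forest [set e | enum_rank e \notin S]%SET.

Lemma card_coforest : #|[set S | coforest S]%SET| = tau G.
Proof.
pose h (F : {set edge G}) := [set i : 'I_#|edge G| | enum_val i \notin F]%SET.
have hinj : injective h.
  move=> F F' /setP e; apply/setP => x; have := e (enum_rank x).
  by rewrite !inE enum_rankK => /negb_inj.
rewrite /tau -(card_imset _ hinj); apply: eq_card => S; rewrite inE.
apply/idP/imsetP => [cS|[F + ->]].
  exists [set e | enum_rank e \notin S]%SET; first by rewrite inE.
  by apply/setP => i; rewrite !inE enum_valK negbK.
rewrite inE /coforest => mF; congr (maximal_forest _): mF.
by apply/setP => e; rewrite !inE enum_rankK negbK.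
Qed.

Lemma graph_lattice_basis n : \dim (ker_cV D) = n ->
  exists B : 'M[int]_(#|edge G|, n),
  [/\ D *m map_mx intr B = 0,
      forall x : 'cV[R]_#|edge G|, D *m x = 0 -> exists t, x = map_mx intr B *m t,
      forall z : 'cV[int]_#|edge G|, D *m map_mx intr z = 0 -> exists k, z = B *m k,
      forall t : 'cV[R]_n, map_mx intr B *m t = 0 -> t = 0 &
      \det (B^T *m B) = (tau G)%:Z].
Proof.
rewrite -card_coforest.
have Q_inj S : coforest S -> forall x : 'cV[R]_#|edge G|, D *m x = 0 ->
    (forall i, i \in S -> x i 0 = 0) -> x = 0.
  move=> cS x /kernelE kx xS; have [acF _] := maximal_forestP cS.
  have x0 := acyclic_kernel0 d_out d_in acF kx.
  apply/matrixP => i j; rewrite (ord1 j) -[i]enum_valK x0 ?mxE // => e.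
  by rewrite inE negbK => /xS.
have Q_dual S : coforest S -> forall i, i \in S -> exists z : 'cV[int]_#|edge G|,
    [/\ D *m map_mx intr z = 0, z i 0 = 1 &
      forall j, j \in S -> j != i -> z j 0 = 0].
  move=> cS i iS.
  have iF : enum_val i \notin [set e | enum_rank e \notin S]%SET.
    by rewrite inE negbK enum_valK.
  have [z [kz z1 z0]] := fundamental_cycle d_out d_in sg_sq d_sg cS iF.
  exists (\col_j z (enum_val j)); split; last 1 first.
  - move=> j jS ji; rewrite mxE z0 ?inE ?negbK ?enum_valK //.
    by rewrite (inj_eq enum_val_inj).
  - apply/kernelE => v; rewrite -[RHS](mulr0z (1 : R)) -(kz v) rmorph_sum /=.
    by apply: eq_bigr => e _; rewrite !mxE enum_rankK intrM.
  - by rewrite mxE.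
apply: (kernel_lattice_basis (Q := coforest)) => //.
  have [F mF _] := exists_maximal_forest (@acyclic_set0 G).
  exists [set i : 'I_#|edge G| | enum_val i \notin F]%SET; congr (maximal_forest _): mF.
  by apply/setP => e; rewrite !inE enum_rankK negbK.
(* If [F] is acyclic, it extends to a maximal forest whose complement lies in [S] and has the same
   cardinality [\dim V], so [S] would be a coforest. Otherwise a cycle inside [F] gives a kernel
   vector that vanishes on [S]. *)
move=> S cS nQ; set F := [set e | enum_rank e \notin S]%SET.
have [acF|] := pselect (acyclic F).
  have [F' mF' FF'] := exists_maximal_forest acF.
  pose S' := [set i : 'I_#|edge G| | enum_val i \notin F']%SET.
  have F'E : F' = [set e | enum_rank e \notin S']%SET.
    by apply/setP => e; rewrite !inE enum_rankK negbK.
  have cS' : coforest S' by rewrite /coforest -F'E.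
  have S'S : S' \subset S.
    apply/fintype.subsetP => i; rewrite inE; apply: contraR => iS.
    by apply: (fintype.subsetP FF'); rewrite inE enum_valK.
  case/negP: nQ; suff <- : S' = S by [].
  by apply/eqP; rewrite eqEcard S'S cS (dim_good Q_inj Q_dual cS') leqnn.
move=> /contrapT [s cs sF].
have [z [kz z0 z1]] := cycle_kernel d_out d_in sg_sq d_sg cs.
exists (\col_j (z (enum_val j))%:~R); split.
- have /andP [s1 _] := cs; case: s s1 cs sF z0 z1 => // a s _ cs sF z0 z1.
  apply/eqP => /matrixP /(_ (enum_rank a.2) 0) /eqP.
  rewrite !mxE enum_rankK intr_eq0 => /eqP za.
  by have := z1 a.2 (mem_head _ _); rewrite za.
- apply/kernelE => v; rewrite -[RHS](mulr0z (1 : R)) -(kz v) rmorph_sum /=.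
  by apply: eq_bigr => e _; rewrite !mxE enum_rankK intrM.
- move=> i iS; rewrite mxE z0 //; apply/negP => /mapP [a as_ ia].
  by have := sF _ as_; rewrite inE -ia enum_valK iS.
Qed.

End GraphLattice.

(** In the bipartite case each edge has exactly one end in [A], so its two ends carry opposite signs
    and the signed entries cancel; in the oriented case the entries cancel already. *)
Lemma incidence_lattice_basis (R : realType) (G : multigraph) (o : orientation G)
    (D : 'M[R]_(#|vertex G|, #|edge G|)) n :
  (bipartite G /\ D = unsigned_incidence R o) \/ D = signed_incidence R o ->
  \dim (ker_cV D) = n ->
  exists B : 'M[int]_(#|edge G|, n),
  [/\ D *m map_mx intr B = 0,
      forall x : 'cV[R]_#|edge G|, D *m x = 0 -> exists t, x = map_mx intr B *m t,
      forall z : 'cV[int]_#|edge G|, D *m map_mx intr z = 0 -> exists k, z = B *m k,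
      forall t : 'cV[R]_n, map_mx intr B *m t = 0 -> t = 0 &
      \det (B^T *m B) = (tau G)%:Z].
Proof.
have hd e : Defs.head o e != tail o e.
  apply/eqP => h; have := card_ends e.
  by rewrite (ends_orient o) h finset.setUid cards1.
move=> [[[A hA] ->]|->].
  apply: (graph_lattice_basis (d := fun v e => (v \in ends e)%:R)
    (sg := fun v => if v \in A then 1 else -1)).
  - by move=> v e /negPf ->.
  - by move=> v e ->.
  - by move=> v; case: ifP.
  - move=> u w e uw eE; rewrite eE !inE !eqxx orbT.
    have := hA e; rewrite eE finset.setIUl cardsU.
    rewrite finset.setIACA finset.setIid.
    have -> : ([set u] :&: [set w] = finset.set0)%SET.
      apply/setP => v; rewrite !inE; apply/negP => /andP [/eqP -> /eqP].
      by move/eqP: uw.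
    rewrite finset.set0I cards0 subn0.
    have cA v : #|[set v] :&: A|%SET = (v \in A).
      case: (boolP (v \in A)) => vA.
        by rewrite (finset.setIidPl _) ?cards1 // finset.sub1set.
      apply/eqP; rewrite cards_eq0 -finset.subset0; apply/fintype.subsetP => x.
      by rewrite !inE => /andP [/eqP ->]; rewrite (negPf vA).
    by rewrite !cA; case: (u \in A); case: (w \in A).
  - move=> i j; rewrite !mxE (ends_orient o) !inE.
    by move=> /=; case: (_ == tail o _); case: (_ == Defs.head o _);
      rewrite /= ?normrN1 ?normr1 ?normr0.
apply: (graph_lattice_basis (d := fun v e =>
  if v == tail o e then 1 else if v == Defs.head o e then -1 else 0)
  (sg := fun v => 1)).
- by move=> v e; rewrite (ends_orient o) !inE negb_or => /andP [/negPf -> /negPf ->].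
- by move=> v e; rewrite (ends_orient o) !inE => /orP [] /eqP ->;
    rewrite ?(negPf (hd e)) ?eqxx.
- by [].
- move=> u w e uw; rewrite (ends_orient o) => eE.
  have : u \in [set tail o e; Defs.head o e]%SET by rewrite eE !inE eqxx.
  have : w \in [set tail o e; Defs.head o e]%SET by rewrite eE !inE eqxx orbT.
  rewrite !inE => /orP [] /eqP wE /orP [] /eqP uE; move: uw; rewrite wE uE ?eqxx //;
  by rewrite ?(negPf (hd e)).
- move=> i j; rewrite !mxE /=.
  by case: (_ == tail o _) => //; case: (_ == Defs.head o _).
Qed.

(** * Lattice sums of Gaussians *)

Lemma esumZl (R : realType) (T : choiceType) (I : set T) (a : T -> \bar R) (x : R) :
  0 <= x -> (forall i, (0 <= a i)%E) ->
  (\esum_(i in I) (x%:E * a i) = x%:E * \esum_(i in I) a i)%E.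
Proof.
move=> x0 a0; rewrite /esum -ereal_supZl //; last first.
  apply/set0P; exists (\sum_(i \in set0) a i)%E.
  by exists set0 => //; exact: fsets_set0.
congr ereal_sup; apply/seteqP; split=> y /=.
  move=> [A IA <-]; exists (\sum_(i \in A) a i)%E; first by exists A.
  by rewrite ge0_mule_fsumr.
by move=> [_ [A IA <-] <-]; exists A => //; rewrite ge0_mule_fsumr.
Qed.

(** * One-dimensional Gaussian sums, uniformly in the shift *)

Section GaussSum1.
Variable R : realType.
Implicit Types (h s : R).

Lemma gauss_fun_even s : gauss_fun (- s) = gauss_fun s.
Proof. by rewrite /gauss_fun sqrrN. Qed.

Lemma gauss_fun_decr (x y : R) : 0 <= x -> x <= y -> gauss_fun y <= gauss_fun x.
Proof.
move=> x0 xy; rewrite /gauss_fun ler_expR lerN2 !expr2.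
by rewrite ler_pM // (le_trans x0).
Qed.

Lemma integral_gauss_itv h (k : nat) : 0 < h ->
  ((h * gauss_fun (h * k.+1%:R))%:E
   <= \int[lebesgue_measure]_(x in `[(h * k%:R)%R, (h * k.+1%:R)%R[)
        (gauss_fun x)%:E
   <= (h * gauss_fun (h * k%:R))%:E)%E.
Proof.
move=> h0; set I := `[_, _[%classic.
have mI : measurable I by exact: measurable_itv.
have hk : h * k%:R < h * k.+1%:R by rewrite ltr_pM2l // ltr_nat.
have hk0 : 0 <= h * k%:R by rewrite mulr_ge0 // ltW.
have muI : lebesgue_measure I = h%:E.
  rewrite /I lebesgue_measure_itv /= lte_fin hk -EFinB -mulrBr -natrB //.
  by rewrite subSnn mulr1.
have cst (c : R) : (\int[lebesgue_measure]_(x in I) c%:E = (h * c)%:E)%E.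
  transitivity (c%:E * lebesgue_measure I)%E; first by rewrite integral_cst.
  by rewrite muI -EFinM mulrC.
have mg : measurable_fun I (EFin \o @gauss_fun R).
  by apply/measurable_EFinP/measurable_funTS; exact: measurable_gauss_fun.
rewrite -!cst; apply/andP; split; apply: ge0_le_integral => //=.
- by move=> x _; rewrite lee_fin gauss_fun_ge0.
- move=> x; rewrite /I /= in_itv /= => /andP [x1 x2].
  by rewrite lee_fin gauss_fun_decr ?(le_trans hk0) // ltW.
- by move=> x _; rewrite lee_fin gauss_fun_ge0.
- move=> x; rewrite /I /= in_itv /= => /andP [x1 x2].
  by rewrite lee_fin gauss_fun_decr.
Qed.

Lemma integral_gauss_series h : 0 < h ->
  (\sum_(k <oo) \int[lebesgue_measure]_(x in `[(h * k%:R)%R, (h * k.+1%:R)%R[)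
     (gauss_fun x)%:E = (Num.sqrt pi / 2)%:E :> \bar R)%E.
Proof.
move=> h0; rewrite -integral0y_gauss.
have hb (k k' : nat) x : h * k%:R <= x -> x < h * k'.+1%:R -> (k <= k')%N.
  move=> h1 h2; have := le_lt_trans h1 h2.
  by rewrite ltr_pM2l // ltr_nat ltnS.
have -> : `[0%R, +oo[%classic = \bigcup_k `[h * k%:R, h * k.+1%:R[%classic.
  apply/seteqP; split=> x /=.
    rewrite in_itv /= andbT => x0.
    have xh : 0 <= x / h by rewrite divr_ge0 // ltW.
    have /andP [x1 x2] := truncn_itv xh.
    exists (Num.truncn (x / h)) => //=; rewrite in_itv /= mulrC -ler_pdivlMr //.
    by rewrite x1 mulrC -ltr_pdivrMr.
  move=> [k _ /=]; rewrite !in_itv /= andbT => /andP [+ _]; apply: le_trans.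
  by rewrite mulr_ge0 // ltW.
rewrite ge0_integral_bigcup //=.
- by apply/measurable_EFinP/measurable_funTS; exact: measurable_gauss_fun.
- by move=> x _; rewrite lee_fin gauss_fun_ge0.
- apply/trivIsetP => i j _ _ ij; apply/eqP.
  apply/negPn/negP => /set0P [x [/= ]]; rewrite !in_itv /=.
  move=> /andP [a1 a2] /andP [b1 b2]; case/negP: ij.
  by rewrite eqn_leq (hb _ _ _ a1 b2) (hb _ _ _ b1 a2).
Qed.

(** On the half-line the Gaussian decreases. For a shift in [[0, h]], both the sum and the integral
    therefore lie between [W] and [U], which differ only by the term of index 0, equal to [h]. *)
Lemma half_gauss_sum h s : 0 < h -> 0 <= s <= h ->
  ((Num.sqrt pi / 2 - h)%:E <= \sum_(k <oo) (h * gauss_fun (h * k%:R + s))%:E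
   <= (Num.sqrt pi / 2 + h)%:E)%E.
Proof.
move=> h0 /andP [s0 sh].
have g0 (f : nat -> R) k : (0 <= (h * gauss_fun (f k))%:E)%E.
  by rewrite lee_fin mulr_ge0 ?gauss_fun_ge0 // ltW.
set S := (\sum_(k <oo) _)%E.
pose W := (\sum_(k <oo) (h * gauss_fun (h * k.+1%:R))%:E)%E.
pose U := (\sum_(k <oo) (h * gauss_fun (h * k%:R))%:E)%E.
have UW : U = (h%:E + W)%E.
  rewrite /U nneseries_recl //; last by move=> k _; exact: (g0 (fun k => h * k%:R)).
  congr (_ + _)%E; first by rewrite mulr0 /gauss_fun expr0n /= oppr0 expR0 mulr1.
  rewrite -(nneseries_addn 1); last by move=> k; exact: (g0 (fun k => h * k%:R)).
  by apply: eq_eseriesr => k _; rewrite addn1.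
have hk0 (k : nat) : 0 <= h * k%:R by rewrite mulr_ge0 // ltW.
have WS : (W <= S)%E.
  apply: lee_nneseries => [k _ _|k _]; first exact: (g0 (fun k => h * k.+1%:R)).
  rewrite lee_fin ler_pM2l // gauss_fun_decr // ?addr_ge0 //.
  by rewrite -(natr1 k) mulrDr mulr1 lerD2l.
have SU : (S <= U)%E.
  apply: lee_nneseries => [k _ _|k _]; first exact: (g0 (fun k => h * k%:R + s)).
  by rewrite lee_fin ler_pM2l // gauss_fun_decr // lerDl.
have WI : (W <= (Num.sqrt pi / 2)%:E)%E.
  rewrite -(integral_gauss_series h0); apply: lee_nneseries => [k _ _|k _].
    exact: (g0 (fun k => h * k.+1%:R)).
  by have /andP [] := integral_gauss_itv k h0.
have IU : ((Num.sqrt pi / 2)%:E <= U)%E.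
  rewrite -(integral_gauss_series h0); apply: lee_nneseries => [k _ _|k _].
    by apply: integral_ge0 => x _; rewrite lee_fin gauss_fun_ge0.
  by have /andP [] := integral_gauss_itv k h0.
apply/andP; split.
  rewrite EFinB leeBlDr //; apply: (le_trans IU).
  by rewrite UW addeC leeD2r.
by apply: (le_trans SU); rewrite UW EFinD [leRHS]addeC leeD2l.
Qed.

(** Translating the index brings the shift into [[0, h]]; each of the two half-lines then
    contributes an error of at most [h]. *)
Lemma gauss_sum_int h s : 0 < h ->
  ((Num.sqrt pi - 2 * h)%:E <=
    \esum_(k in [set: int]) (h * gauss_fun (s + h * k%:~R))%:E
   <= (Num.sqrt pi + 2 * h)%:E)%E.
Proof.
move=> h0; pose m := Num.floor (s / h); pose t := s - h * m%:~R.
have t0 : 0 <= t by rewrite subr_ge0 mulrC -ler_pdivlMr // real_floor_le // num_real.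
have th : t <= h.
  rewrite lerBlDr mulrC -[X in X + _]mul1r -mulrDl -ler_pdivrMr //.
  have /ltW := real_floorD1_gt (num_real (s / h)).
  by rewrite intrD addrC.
pose F (k : int) : \bar R := (h * gauss_fun (t + h * k%:~R))%:E.
have F0 k : (0 <= F k)%E by rewrite lee_fin mulr_ge0 ?gauss_fun_ge0 // ltW.
have -> : (\esum_(k in [set: int]) (h * gauss_fun (s + h * k%:~R))%:E =
    \esum_(k in [set: int]) F k)%E.
  rewrite (@reindex_esum _ _ _ [set: int] [set: int] (fun k => k + m)%R F).
    apply: eq_esum => k _; rewrite /F /t intrD mulrDr.
    by congr (_ * gauss_fun _)%:E; ring.
  split=> //; first by move=> a b _ _ /addIr.
  by move=> k _; exists (k - m)%R => //; rewrite subrK.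
(* By evenness the negative indices form a half-line sum as well: the index [Negz k] is [- (k + 1)],
   and [t - h (k + 1)] is the opposite of [h k + (h - t)]. *)
have -> : (\esum_(k in [set: int]) F k =
    \sum_(k <oo) (h * gauss_fun (h * k%:R + t))%:E +
    \sum_(k <oo) (h * gauss_fun (h * k%:R + (h - t)))%:E)%E.
  rewrite (esumID (range Posz)) //; congr (_ + _)%E.
    rewrite setTI esum_image; last by move=> a b _ _ [].
    rewrite -nneseries_esumT //.
    by apply: eq_eseriesr => k _; rewrite /F addrC.
  have -> : [set: int] `&` ~` range Posz = range Negz.
    apply/seteqP; split=> [[k|k] [_ /= nk]|_ [k _ <-]].
    - by exfalso; apply: nk; exists k.
    - by exists k.
    - by split=> // -[].
  rewrite esum_image; last by move=> a b _ _ [].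
  rewrite -nneseries_esumT //; apply: eq_eseriesr => k _; rewrite /F.
  rewrite -gauss_fun_even; congr (_ * gauss_fun _)%:E.
  by rewrite NegzE mulrNz -pmulrn -natr1; ring.
have /andP [l1 u1] := @half_gauss_sum h t h0 (introT andP (conj t0 th)).
have ht : 0 <= h - t <= h by apply/andP; split; lra.
have /andP [l2 u2] := @half_gauss_sum h (h - t) h0 ht.
apply/andP; split.
  apply: le_trans (leeD l1 l2); rewrite -EFinD lee_fin; lra.
apply: le_trans (leeD u1 u2) _; rewrite -EFinD lee_fin; lra.
Qed.

End GaussSum1.

(** * Gaussian sums in any dimension *)

Section GaussSum.
Variable R : realType.

Definition qform n (A : 'M[R]_n) (x : 'cV[R]_n) : R := (x^T *m A *m x) 0 0.

Definition posdef n (A : 'M[R]_n) := forall x, x != 0 -> 0 < qform A x.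

(** For [A] positive definite, this is the value of the integral of [exp (- qform A x)] over the
    whole space. *)
Definition gauss_cst n (A : 'M[R]_n) : R := Num.sqrt (pi ^+ n / \det A).

Definition gauss_sum n (A : 'M[R]_n) (h : R) (s : 'cV[R]_n) : \bar R :=
  (\esum_(k in [set: 'cV[int]_n])
     (expR (- qform A (s + h *: map_mx intr k)))%:E)%E.

Definition schur_compl n (A : 'M[R]_(1 + n)) : 'M[R]_n :=
  drsubmx A - (A 0 0)^-1 *: (dlsubmx A *m ursubmx A).

Section Schur.
Variables (n : nat) (A : 'M[R]_(1 + n)).
Hypotheses (symA : A^T = A) (pA : posdef A).
Let a := A 0 0.
Let c : 'rV[R]_n := a^-1 *: ursubmx A.

Lemma posdef_pivot : 0 < a.
Proof.
have /pA : (delta_mx 0 0 : 'cV[R]_(1 + n)) != 0.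
  by apply/eqP => /matrixP /(_ 0 0) /eqP; rewrite !mxE !eqxx oner_eq0.
by rewrite /qform trmx_delta -rowE -colE !mxE.
Qed.

Lemma qform_schur (x : 'cV[R]_1) (y : 'cV[R]_n) :
  qform A (col_mx x y) =
  a * (x 0 0 + (c *m y) 0 0) ^+ 2 + qform (schur_compl A) y.
Proof.
have a0 : a != 0 by rewrite gt_eqF // posdef_pivot.
have ulE : ulsubmx A = a%:M.
  apply/matrixP => i j; rewrite !mxE !ord1 eqxx mulr1n /a.
  by congr (A _ _); apply/val_inj.
have dlE : dlsubmx A = (ursubmx A)^T by rewrite trmx_ursub symA.
pose u := (ursubmx A *m y) 0 0.
have uE : ursubmx A *m y = u%:M by exact: mx11_scalar.
have xE : x = (x 0 0)%:M by exact: mx11_scalar.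
have h1 : (x^T *m ulsubmx A *m x) 0 0 = a * x 0 0 ^+ 2.
  rewrite ulE mul_mx_scalar -scalemxAl mxE xE tr_scalar_mx mul_scalar_mx.
  by rewrite !mxE eqxx !mulr1n expr2.
have h2 : (x^T *m ursubmx A *m y) 0 0 = x 0 0 * u.
  by rewrite -mulmxA uE xE tr_scalar_mx mul_scalar_mx !mxE eqxx !mulr1n.
have h3 : (y^T *m dlsubmx A *m x) 0 0 = x 0 0 * u.
  rewrite dlE -trmx_mul uE xE tr_scalar_mx mul_scalar_mx !mxE eqxx !mulr1n.
  exact: mulrC.
have h4 : qform (schur_compl A) y = (y^T *m drsubmx A *m y) 0 0 - a^-1 * u ^+ 2.
  rewrite /qform /schur_compl mulmxBr mulmxBl mxE [X in _ + X]mxE -/a; congr (_ - _).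
  rewrite -scalemxAr -scalemxAl mxE; congr (_ * _).
  rewrite dlE -!mulmxA uE mulmxA -trmx_mul uE tr_scalar_mx mul_scalar_mx.
  by rewrite !mxE eqxx !mulr1n expr2.
have cyE : (c *m y) 0 0 = a^-1 * u by rewrite /c -scalemxAl mxE.
rewrite h4 cyE.
rewrite /qform -[A in LHS]submxK tr_col_mx mul_row_block mul_row_col !mulmxDl.
rewrite [LHS]mxE [X in X + _]mxE [X in _ + X]mxE h1 h2 h3.
by move: (_ 0 0) => q; field.
Qed.

Lemma det_schur : \det A = a * \det (schur_compl A).
Proof.
have a0 : a != 0 by rewrite gt_eqF // posdef_pivot.
have ulE : ulsubmx A = a%:M.
  apply/matrixP => i j; rewrite !mxE !ord1 eqxx mulr1n /a.
  by congr (A _ _); apply/val_inj.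
have /(congr1 determinant) -> : A = block_mx 1%:M 0 (a^-1 *: dlsubmx A) 1%:M *m
    block_mx a%:M (ursubmx A) 0 (schur_compl A).
  rewrite mulmx_block !mul1mx !mul0mx !addr0 -scalemxAl mul_mx_scalar scalerA.
  rewrite mulVf // scale1r -scalemxAl addrC subrK -ulE.
  by rewrite submxK.
by rewrite det_mulmx det_lblock det_ublock !det1 !mul1r det_scalar expr1.
Qed.

Lemma schur_sym : (schur_compl A)^T = schur_compl A.
Proof.
have ur : (ursubmx A)^T = dlsubmx A by rewrite trmx_ursub symA.
rewrite /schur_compl linearB /= linearZ /= trmx_mul ur trmx_drsub symA.
by rewrite -ur trmxK.
Qed.

(** Taking [- (c *m y)] as first coordinate kills the completed square, so the form of the Schur
    complement is a value of [qform A]. *)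
Lemma schur_posdef : posdef (schur_compl A).
Proof.
move=> y y0; have := @pA (col_mx (- (c *m y)) y).
rewrite qform_schur mxE addNr expr0n /= mulr0 add0r; apply.
by apply: contra y0 => /eqP; rewrite -[0](@col_mx0 _ 1 n) => /eq_col_mx [_ ->].
Qed.

End Schur.

(** A dilation by [sqrt a] reduces to the standard Gaussian; dividing by [sqrt a] afterwards
    restores the error [2 h], which thus depends neither on [a] nor on [s]. *)
Lemma gauss_sum_scaled1 (a h s : R) : 0 < a -> 0 < h ->
  ((Num.sqrt (pi / a) - 2 * h)%:E <=
    \esum_(k in [set: int]) (h * expR (- (a * (s + h * k%:~R) ^+ 2)))%:E
   <= (Num.sqrt (pi / a) + 2 * h)%:E)%E.
Proof.
move=> a0 h0; have sa : 0 < Num.sqrt a by rewrite sqrtr_gt0.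
have := @gauss_sum_int R (Num.sqrt a * h) (Num.sqrt a * s) (mulr_gt0 sa h0).
have -> : (\esum_(k in [set: int]) (Num.sqrt a * h *
    gauss_fun (Num.sqrt a * s + Num.sqrt a * h * k%:~R))%:E =
  (Num.sqrt a)%:E * \esum_(k in [set: int])
    (h * expR (- (a * (s + h * k%:~R) ^+ 2)))%:E)%E.
  rewrite -esumZl ?ltW //; last first.
    by move=> k; rewrite lee_fin mulr_ge0 ?expR_ge0 // ltW.
  apply: eq_esum => k _; rewrite -EFinM mulrA; congr (_ * expR (- _))%:E.
  by rewrite -mulrA -mulrDr exprMn sqr_sqrtr // ltW.
rewrite sqrtrM ?pi_ge0 // (sqrtrV (ltW a0)) => /andP [l u].
have saE b : Num.sqrt a * (Num.sqrt pi / Num.sqrt a + b * h) =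
    Num.sqrt pi + b * (Num.sqrt a * h) by field; rewrite gt_eqF.
apply/andP; split; rewrite -(@lee_pmul2l _ (Num.sqrt a)%:E) ?lte_fin //.
  by apply: le_trans l; rewrite -EFinM lee_fin -mulNr saE mulNr.
by apply: le_trans u _; rewrite -EFinM lee_fin saE.
Qed.

Lemma gauss_cst_schur n (A : 'M[R]_(1 + n)) : A^T = A -> posdef A ->
  gauss_cst A = Num.sqrt (pi / A 0 0) * gauss_cst (schur_compl A).
Proof.
move=> symA pA; rewrite /gauss_cst det_schur // exprS.
rewrite -sqrtrM ?divr_ge0 ?pi_ge0 ?ltW ?posdef_pivot //.
by rewrite invfM mulrACA.
Qed.

Lemma esum_col_mx n (F : 'cV[int]_(1 + n) -> \bar R) : (forall k, 0 <= F k)%E ->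
  (\esum_(k in [set: 'cV[int]_(1 + n)]) F k =
   \esum_(k in [set: 'cV[int]_n]) \esum_(j in [set: int])
     F (col_mx (const_mx j) k))%E.
Proof.
move=> F0; rewrite esum_esum //.
rewrite (@reindex_esum _ _ _ ([set: 'cV[int]_n] `*`` fun=> [set: int]) setT
  (fun k => col_mx (const_mx k.2) k.1) F) //.
split=> //; first by move=> [k j] [k' j'] _ _ /= /eq_col_mx [/matrixP /(_ 0 0)];
  rewrite !mxE => -> ->.
move=> k _; exists (dsubmx k, usubmx k 0 0) => //=.
rewrite -[RHS](vsubmxK k); congr col_mx.
by apply/matrixP => i j; rewrite !mxE !ord1.
Qed.

(** Once the square is completed, the sum over the first coordinate is one-dimensional, but its
    shift depends on the other coordinates [k]. Only a bound uniform in the shift can be taken out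
    of the outer sum. *)
Lemma gauss_sum_schur n (A : 'M[R]_(1 + n)) h (s : 'cV[R]_(1 + n)) :
  A^T = A -> posdef A -> 0 < h ->
  ((h ^+ (1 + n))%:E * gauss_sum A h s = (h ^+ n)%:E *
    \esum_(k in [set: 'cV[int]_n])
      ((expR (- qform (schur_compl A) (dsubmx s + h *: map_mx intr k)))%:E *
       \esum_(j in [set: int]) (h * expR (- (A 0 0 * (((usubmx s) 0 0 +
         ((A 0 0)^-1 *: ursubmx A *m (dsubmx s + h *: map_mx intr k)) 0 0)
           + h * j%:~R) ^+ 2)))%:E))%E.
Proof.
move=> symA pA h0; rewrite /gauss_sum esum_col_mx; last first.
  by move=> k; rewrite lee_fin expR_ge0.
rewrite exprSr EFinM -muleA -esumZl ?(ltW h0) //; last first.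
  by move=> k; apply: esum_ge0 => j _; rewrite lee_fin expR_ge0.
congr (_ * _)%E; apply: eq_esum => k _.
rewrite -esumZl; [|exact: ltW|by move=> j; rewrite lee_fin expR_ge0].
rewrite -esumZl ?expR_ge0 //; last first.
  by move=> j; rewrite lee_fin mulr_ge0 ?expR_ge0 // ltW.
apply: eq_esum => j _; rewrite -!EFinM mulrCA -expRD -opprD.
congr (_ * expR (- _))%:E.
have -> : s + h *: map_mx intr (col_mx (const_mx j) k) =
    col_mx (usubmx s + h *: const_mx j%:~R) (dsubmx s + h *: map_mx intr k).
  by rewrite -[s in LHS]vsubmxK map_col_mx scale_col_mx add_col_mx map_const_mx.
rewrite (qform_schur symA pA) addrC; congr (_ + _ * _ ^+ 2).
have -> : (usubmx s + h *: const_mx j%:~R) 0 0 = usubmx s 0 0 + h * j%:~R.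
  by rewrite mxE [X in _ + X]mxE [X in _ * X]mxE.
exact: addrAC.
Qed.

Lemma gauss_sum_cvg n (A : 'M[R]_n) : A^T = A -> posdef A ->
  forall e, 0 < e -> exists2 h0, 0 < h0 & forall h s, 0 < h -> h < h0 ->
  ((gauss_cst A - e)%:E <= (h ^+ n)%:E * gauss_sum A h s
     <= (gauss_cst A + e)%:E)%E.
Proof.
elim: n A => [|n IH] A symA pA e e0.
  exists 1 => // h s _ _; rewrite /gauss_cst det_mx00 expr0 divr1 sqrtr1 mul1e.
  have -> : gauss_sum A h s = 1%:E.
    rewrite /gauss_sum.
    have -> : [set: 'cV[int]_0] = [set 0].
      by apply/seteqP; split=> // k _ /=; apply/matrixP => -[].
    rewrite esum_set1 ?lee_fin ?expR_ge0 //.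
    by rewrite /qform mxE big_ord0 oppr0 expR0.
  by rewrite !lee_fin; apply/andP; split; lra.
have sS := schur_sym symA; have pS := schur_posdef symA pA.
set S := schur_compl A in sS pS.
pose a := A 0 0; have a0 : 0 < a := posdef_pivot pA.
pose G := gauss_cst S; have G0 : 0 <= G by apply: sqrtr_ge0.
pose p := Num.sqrt (pi / a).
have p0 : 0 < p by rewrite sqrtr_gt0 divr_gt0 ?pi_gt0.
have AE : gauss_cst A = p * G by exact: gauss_cst_schur.
(* The product [(p + 2 h) (G + e1)] exceeds [p G] by at most [p e1 + 2 h (G + 1)]. The choices of
   [e1] and [h2] make these terms at most [e / 4] and [e / 2]; moreover [h < p / 2] keeps the factor
   [p - 2 h] of the lower bound nonnegative. *)
pose e1 := Num.min 1 (e / (4 * p)).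
have e10 : 0 < e1 by rewrite lt_min ltr01 divr_gt0 // mulr_gt0.
have [h1 h10 h1P] := IH S sS pS e1 e10.
pose h2 := Num.min (p / 2) (e / (4 * (G + 1))).
have h20 : 0 < h2 by rewrite lt_min !divr_gt0 // mulr_gt0 // ltr_wpDl.
exists (Num.min h1 h2); first by rewrite lt_min h10.
move=> h s h0; rewrite !lt_min => /andP [hh1 /andP [hh2 hh3]].
have /andP [l u] := h1P h (dsubmx (s : 'cV_(1 + n))) h0 hh1.
set s2 : 'cV[R]_n := dsubmx _ in l u.
pose E (k : 'cV[int]_n) : \bar R :=
  (expR (- qform S (s2 + h *: map_mx intr k)))%:E.
pose I (k : 'cV[int]_n) : \bar R := (\esum_(j in [set: int]) (h * expR (- (a *
  (((usubmx (s : 'cV_(1 + n))) 0 0 +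
     (a^-1 *: ursubmx (A : 'M[R]_(1 + n)) *m (s2 + h *: map_mx intr k)) 0 0)
    + h * j%:~R) ^+ 2)))%:E)%E.
rewrite AE (_ : (_ * _ = (h ^+ n)%:E *
    \esum_(k in [set: 'cV[int]_n]) (E k * I k))%E); last exact: gauss_sum_schur.
have E0 k : (0 <= E k)%E by rewrite lee_fin expR_ge0.
have IB k : ((p - 2 * h)%:E <= I k <= (p + 2 * h)%:E)%E.
  exact: gauss_sum_scaled1.
have hn0 : (0 <= (h ^+ n)%:E)%E by rewrite lee_fin exprn_ge0 // ltW.
have hG : h * (4 * (G + 1)) <= e.
  by rewrite -ler_pdivlMr ?mulr_gt0 // ?ltr_wpDl // ltW.
have ep : e1 * (4 * p) <= e.
  by rewrite -ler_pdivlMr ?mulr_gt0 // /e1 ge_min lexx orbT.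
have e1le : e1 <= 1 by rewrite ge_min lexx.
have ph : 0 <= p - 2 * h by lra.
apply/andP; split.
  apply: (@le_trans _ _ ((p - 2 * h)%:E * ((h ^+ n)%:E * gauss_sum S h s2))%E).
    apply: (@le_trans _ _ ((p - 2 * h)%:E * (G - e1)%:E)%E).
      rewrite -EFinM lee_fin; nra.
    by rewrite lee_wpmul2l // lee_fin.
  rewrite muleCA lee_wpmul2l // -esumZl //.
  apply: le_esum => k _; rewrite muleC lee_wpmul2l //.
  by have /andP [] := IB k.
apply: (@le_trans _ _ ((p + 2 * h)%:E * ((h ^+ n)%:E * gauss_sum S h s2))%E).
  rewrite muleCA lee_wpmul2l // -esumZl //; last by rewrite addr_ge0 ?mulr_ge0 ?ltW.
  apply: le_esum => k _; rewrite [leRHS]muleC lee_wpmul2l //.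
  by have /andP [] := IB k.
apply: (@le_trans _ _ ((p + 2 * h)%:E * (G + e1)%:E)%E).
  by rewrite lee_wpmul2l // lee_fin addr_ge0 ?mulr_ge0 ?ltW.
rewrite -EFinM lee_fin; nra.
Qed.

End GaussSum.

(** * Second-order calculus *)

Lemma le_coord_norm (R : realType) m n (x : 'M[R]_(m, n)) i j :
  `|x i j| <= `|x|.
Proof.
rewrite [leRHS]mx_normrE.
exact: (le_bigmax _ (fun ij : 'I_m * 'I_n => `|x ij.1 ij.2|) (i, j)).
Qed.

Lemma norm_le_coord (R : realType) m n (x : 'M[R]_(m, n)) (c : R) :
  0 <= c -> (forall i j, `|x i j| <= c) -> `|x| <= c.
Proof.
move=> c0 h; rewrite [leLHS]mx_normrE; apply: bigmax_le => // ij _; exact: h.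
Qed.

Section LineDerivative.
Variables (R : realType) (V : normedModType R) (f : V -> R) (p v : V).

Lemma is_derive_line s : derivable f (p + s *: v) v ->
  is_derive s 1 (fun s => f (p + s *: v)) ('D_v f (p + s *: v)).
Proof.
have E : (fun h => h^-1 *: (((fun s => f (p + s *: v)) \o shift s) (h *: 1)
      - f (p + s *: v))) =
    (fun h => h^-1 *: ((f \o shift (p + s *: v)) (h *: v) - f (p + s *: v))).
  apply/funext => h /=; congr (_ *: (f _ - _)).
  by rewrite [h *: 1]mulr1 scalerDl addrCA.
by move=> df; split; rewrite /derivable /derive E.
Qed.

Lemma MVT_line b : (forall s, `|s| <= `|b| -> derivable f (p + s *: v) v) ->
  exists2 c, `|c| <= `|b| &
    f (p + b *: v) - f p = b * 'D_v f (p + c *: v).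
Proof.
move=> df; pose g s := f (p + s *: v).
have f0 : f p = g 0 by rewrite /g scale0r addr0.
have bnd a c : (forall s, s \in `[a, c] -> `|s| <= `|b|) ->
    {within `[a, c], continuous g} /\ (forall s, s \in `]a, c[ ->
    is_derive s 1 g ('D_v f (p + s *: v))).
  move=> sb; split; last first.
    by move=> s sac; apply/is_derive_line/df/sb/subset_itv_oo_cc.
  apply: derivable_within_continuous => s /sb /df /is_derive_line h.
  exact: ex_derive.
have [b0|b0] := leP 0 b.
  have sb s : s \in `[0, b] -> `|s| <= `|b|.
    by rewrite in_itv /= => /andP [s0 sb]; rewrite !ger0_norm.
  have [cg dg] := bnd _ _ sb.
  have [c cb e] := MVT_segment b0 dg cg.
  exists c; first exact: sb.
  by rewrite f0 -/(g b) e subr0 mulrC.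
have sb s : s \in `[b, 0] -> `|s| <= `|b|.
  rewrite in_itv /= => /andP [sb s0]; rewrite !ler0_norm // ?lerN2 //.
  exact: ltW.
have [cg dg] := bnd _ _ sb.
have [c cb e] := MVT_segment (ltW b0) dg cg.
exists c; first exact: sb.
rewrite f0 -/(g b) -opprB e; ring.
Qed.

End LineDerivative.

Section Differentiability.
Variables (R : realType) (N : nat).
Implicit Types (f : 'cV[R]_N -> R) (x u v : 'cV[R]_N) (A : set 'cV[R]_N).

Definition grad f x v : R := \sum_i v i 0 * partial f i x.

Lemma gradZ f x (c : R) v : grad f x (c *: v) = c * grad f x v.
Proof.
by rewrite /grad mulr_sumr; apply: eq_bigr => i _; rewrite mxE mulrA.
Qed.


Let trunc k u : 'cV[R]_N := \col_i (if (i < k)%N then u i 0 else 0).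

(** The point moves from [x] to [x + u] one coordinate at a time. Each move is governed by the mean
    value theorem for one partial derivative, which is close to its value at [x]. *)
Lemma C1_frechet A f x : open_nbhs x A -> C1_on A f -> forall e, 0 < e ->
  exists2 d, 0 < d & forall u, `|u| < d ->
    `|f (x + u) - f x - grad f x u| <= e * `|u|.
Proof.
move=> [oA Ax] C1 e e0.
(* Each of the [N] moves costs [e1 * |u|]; the successor avoids a division by zero when [N] is 0. *)
pose e1 := e / (N.+1)%:R.
have e10 : 0 < e1 by rewrite divr_gt0.
have : \forall y \near x, A y /\ forall i, `|partial f i y - partial f i x| <= e1.
  near=> y; split; first by near: y; exact: open_nbhs_nbhs.
  near: y; apply: filter_forall => i; have [_ ci] := C1 i x Ax.
  have /cvgrPdist_le /(_ _ e10) := ci.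
  by apply: filterS => y; rewrite distrC.
move=> /nbhs_ballP [d /= d0 dP]; exists d => // u ud.
have dP' w : `|w| <= `|u| -> A (x + w) /\
    forall i, `|partial f i (x + w) - partial f i x| <= e1.
  move=> wu; apply: dP; rewrite -ball_normE /ball_ /= opprD addNKr normrN.
  exact: le_lt_trans ud.
have truncS k (kN : (k < N)%N) :
    trunc k.+1 u = trunc k u + u (Ordinal kN) 0 *: delta_mx (Ordinal kN) 0.
  apply/matrixP => i j; rewrite !mxE (ord1 j) eqxx andbT ltnS leq_eqVlt.
  have [->|ik] := eqVneq i (Ordinal kN).
    by rewrite /= eqxx ltnn mulr1 add0r.
  have -> : (i == k :> nat) = false.
    by apply/negbTE; apply: contra ik => /eqP ik; apply/eqP/val_inj.
  by rewrite /= mulr0 addr0.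
have main k : (k <= N)%N ->
    `|f (x + trunc k u) - f x - grad f x (trunc k u)| <= k%:R * (e1 * `|u|).
  elim: k => [_|k IH kN].
    have -> : trunc 0 u = 0 by apply/matrixP => i j; rewrite !mxE.
    rewrite addr0 subrr /grad big1 ?subrr ?normr0 ?mul0r // => i _.
    by rewrite mxE mul0r.
  have kN' : (k <= N)%N by exact: ltnW.
  set i0 := Ordinal kN; set b := u i0 0.
  (* The norm is the sup norm, so every intermediate point stays within [|u|] of [x]. *)
  have hw s : `|s| <= `|b| -> `|trunc k u + s *: delta_mx i0 0| <= `|u|.
    move=> sb; apply: norm_le_coord => // i j; rewrite !mxE (ord1 j) eqxx andbT.
    have [->|ii] := eqVneq i i0.
      by rewrite ltnn add0r mulr1 (le_trans sb) // le_coord_norm.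
    by rewrite mulr0 addr0; case: ifP => _; rewrite ?normr0 // le_coord_norm.
  have [c cb] : exists2 c, `|c| <= `|b| &
      f (x + trunc k u + b *: delta_mx i0 0) - f (x + trunc k u) =
      b * partial f i0 (x + trunc k u + c *: delta_mx i0 0).
    apply: MVT_line => s sb; rewrite -addrA.
    by have [/(C1 i0) []] := dP' _ (hw _ sb).
  rewrite -2![x + _ + _ *: _]addrA -truncS => fE.
  have [_ /(_ i0) pE] := dP' _ (hw _ cb).
  have gE : grad f x (trunc k.+1 u) = grad f x (trunc k u) + b * partial f i0 x.
    rewrite truncS /grad -/i0 -/b.
    under eq_bigr do rewrite mxE mulrDl.
    rewrite big_split /=; congr (_ + _); rewrite (bigD1 i0) //= big1 ?addr0.
      by rewrite !mxE !eqxx mulr1.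
    by move=> i ii; rewrite !mxE (negPf ii) mulr0 mul0r.
  rewrite gE.
  have -> : f (x + trunc k.+1 u) - f x - (grad f x (trunc k u) + b * partial f i0 x)
    = (f (x + trunc k u) - f x - grad f x (trunc k u)) +
      b * (partial f i0 (x + (trunc k u + c *: delta_mx i0 0)) - partial f i0 x).
    by rewrite mulrBr -fE; ring.
  apply: (le_trans (ler_normD _ _)); rewrite -natr1 mulrDl mul1r lerD ?IH //.
  by rewrite normrM mulrC ler_pM // le_coord_norm.
have trN : trunc N u = u.
  by apply/matrixP => i j; rewrite !mxE (ord1 j) ltn_ord.
have := main N (leqnn N); rewrite trN => /le_trans; apply.
rewrite mulrA ler_wpM2r // /e1 mulrCA -[leRHS]mulr1 ler_wpM2l ?(ltW e0) //.
by rewrite ler_pdivrMr // mul1r ler_nat.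
Unshelve. all: by end_near. Qed.

Lemma C1_is_derive A f x v : open_nbhs x A -> C1_on A f ->
  is_derive x v f (grad f x v).
Proof.
move=> oA C1.
have cv : (fun h => h^-1 *: ((f \o shift x) (h *: v) - f x)) @ 0^' --> grad f x v.
  apply/cvgrPdist_le => e e0.
  have v1 : 0 < `|v| + 1 by rewrite ltr_wpDl.
  have [d d0 dP] := C1_frechet oA C1 (divr_gt0 e0 v1).
  have dv : 0 < d / (`|v| + 1) by rewrite divr_gt0.
  near=> h.
  have h0 : h != 0 by near: h; exact: nbhs_dnbhs_neq.
  have hd : `|h| < d / (`|v| + 1).
    by near: h; apply: dnbhs0_lt.
  have /dP : `|h *: v| < d.
    rewrite normrZ; apply: (le_lt_trans (y := `|h| * (`|v| + 1))).
      by rewrite ler_wpM2l // lerDl.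
    by rewrite -ltr_pdivlMr.
  rewrite gradZ normrZ => hP.
  have -> : grad f x v - h^-1 *: ((f \o shift x) (h *: v) - f x) =
      - (h^-1 * (f (x + h *: v) - f x - h * grad f x v)).
    have key (z g fx : R) : g - h^-1 *: (z - fx) = - (h^-1 * (z - fx - h * g)).
      by rewrite -[h^-1 *: _]/(h^-1 * (z - fx)); field.
    by rewrite /= [h *: v + x]addrC key.
  rewrite normrN normrM normrV ?unitfE // ler_pdivrMl ?normr_gt0 //.
  apply: (le_trans hP); rewrite mulrCA ler_wpM2l // -mulrA ler_piMr ?(ltW e0) //.
  by rewrite mulrC ler_pdivrMr // mul1r lerDl.
split; first by apply: cvgP cv.
exact: cvg_lim cv.
Unshelve. all: by end_near. Qed.

Section SecondOrder.
Variables (A : set 'cV[R]_N) (f : 'cV[R]_N -> R) (x : 'cV[R]_N).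
Hypotheses (oA : open_nbhs x A) (C1f : C1_on A f).
Hypothesis C1p : forall i, C1_on A (partial f i).

Lemma partial_frechet e : 0 < e -> exists2 d, 0 < d & forall u, `|u| < d ->
  A (x + u) /\ forall i,
    `|partial f i (x + u) - partial f i x - \sum_j u j 0 * hessian f x j i|
     <= e * `|u|.
Proof.
move=> e0.
have [dA /= dA0 dAP] : nbhs_ball x A.
  by apply/nbhs_ballP; exact: open_nbhs_nbhs.
have /boolp.choice [d dP] : forall i, exists d, 0 < d /\ forall u, `|u| < d ->
    `|partial f i (x + u) - partial f i x - grad (partial f i) x u| <= e * `|u|.
  by move=> i; have [d d0 dP] := C1_frechet oA (C1p i) e0; exists d.
exists (\big[Num.min/dA]_i d i).
  by apply/bigmin_gtP; split=> // i _; have [] := dP i.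
move=> u /bigmin_gtP [uA ud]; split.
  apply: dAP; rewrite -ball_normE /ball_ /= opprD addNKr normrN //.
move=> i; have [_ h] := dP i; apply: le_trans (h u (ud i isT)).
rewrite le_eqVlt; apply/orP; left; apply/eqP; congr `|_ - _|.
by apply: eq_bigr => j _; rewrite mxE.
Qed.

(* The mixed second difference quotient tends to both mixed partials. *)
Lemma hessian_sym : (hessian f x)^T = hessian f x.
Proof.
apply/matrixP => i j; rewrite mxE.
pose E k : 'cV[R]_N := delta_mx k 0.
pose D s k l := f (x + s *: E k + s *: E l) - f (x + s *: E k)
                 - f (x + s *: E l) + f x.
have Enorm k : `|E k| <= 1.
  apply: norm_le_coord => // a b; rewrite !mxE.
  by case: (_ && _); rewrite ?normr1 ?normr0.
have sumE k l c : \sum_m (c *: E k) m 0 * hessian f x m l = c * hessian f x k l.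
  rewrite (bigD1 k) //= big1 ?addr0.
    by rewrite [X in X * _]mxE [X in _ * X * _]mxE !eqxx mulr1.
  by move=> m mk; rewrite !mxE (negPf mk) mulr0 mul0r.
have sumE2 k l c1 c2 n : \sum_m (c1 *: E k + c2 *: E l) m 0 * hessian f x m n =
    c1 * hessian f x k n + c2 * hessian f x l n.
  rewrite -!sumE -big_split /=; apply: eq_bigr => m _.
  by rewrite [X in X * _]mxE mulrDl.
have quot e : 0 < e -> exists2 d, 0 < d & forall s, 0 < s -> s < d -> forall k l,
    `|D s k l - s ^+ 2 * hessian f x k l| <= e * s ^+ 2.
  (* The partial derivative is expanded at two points whose distances to [x] are at most [2 s] and
     [s]: hence the radius [d / 2] and the factor 3. *)
  move=> e0; have e30 : 0 < e / 3 by rewrite divr_gt0.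
  have [d d0 dP] := partial_frechet e30; exists (d / 2); first by rewrite divr_gt0.
  move=> s s0 sd k l.
  have small (c1 c2 : R) : `|c1| <= s -> `|c2| <= s ->
      `|c1 *: E k + c2 *: E l| <= 2 * s.
    move=> h1 h2; rewrite (le_trans (ler_normD _ _)) // !normrZ.
    rewrite mulr_natl mulr2n lerD //.
      exact: le_trans (ler_piMr (normr_ge0 _) (Enorm k)) h1.
    exact: le_trans (ler_piMr (normr_ge0 _) (Enorm l)) h2.
  have inA c1 c2 : `|c1| <= s -> `|c2| <= s -> A (x + (c1 *: E k + c2 *: E l)).
    move=> h1 h2; apply: (proj1 (dP _ _)).
    by rewrite (le_lt_trans (small _ _ h1 h2)) //; lra.
  have ss : `|s| <= s by rewrite ger0_norm // ltW.
  have z0 : `|0 : R| <= s by rewrite normr0 ltW.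
  have dline (c t : R) : `|c| <= s -> `|t| <= s ->
      is_derive t 1 (fun t => f (x + c *: E k + t *: E l))
        (partial f l (x + c *: E k + t *: E l)).
    move=> hc ht; apply: is_derive_line.
    by have [] := C1f l (inA _ _ hc ht); rewrite addrA.
  (* The second difference is the increment of [g] over [[0, s]]. The vector [0 *: E k] is kept so
     that [dline] applies to both terms. *)
  pose g (t : R) := f (x + s *: E k + t *: E l) - f (x + 0 *: E k + t *: E l).
  pose dg t :=
    partial f l (x + s *: E k + t *: E l) - partial f l (x + 0 *: E k + t *: E l).
  have gP (t : R) : t \in `[0, s] -> is_derive t 1 g (dg t).
    rewrite in_itv /= => /andP [t0 ts].
    have ht : `|t| <= s by rewrite ger0_norm.
    by apply: is_deriveB; apply: dline.
  have gd (t : R) : t \in `]0, s[ -> is_derive t 1 g (dg t).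
    by move=> ts; apply/gP/subset_itv_oo_cc.
  have gc : {within `[0, s], continuous g}.
    by apply: derivable_within_continuous => t /gP h; exact: ex_derive.
  have [t tin gE] := MVT_segment (ltW s0) gd gc.
  move: tin; rewrite in_itv /= => /andP [t0 ts].
  have ht : `|t| <= s by rewrite ger0_norm.
  have -> : D s k l = g s - g 0.
    rewrite /D /g !scale0r !addr0; ring.
  rewrite gE subr0 /dg -!addrA.
  have sm2 : 2 * s < d by lra.
  have [_ /(_ l)] := dP _ (le_lt_trans (small _ _ ss ht) sm2).
  have [_ /(_ l)] := dP _ (le_lt_trans (small _ _ z0 ht) sm2).
  rewrite !sumE2 mul0r add0r.
  have n1 := small _ _ ss ht; have n2 : `|0 *: E k + t *: E l| <= s.
    rewrite scale0r add0r normrZ.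
    exact: le_trans (ler_piMr (normr_ge0 _) (Enorm l)) ht.
  move: n1 n2; set m1 := `|s *: _ + _|; set m2 := `|0 *: _ + _| => n1 n2.
  set p1 := partial f l (x + (0 *: _ + _)); set p2 := partial f l (x + (s *: _ + _)).
  set p3 := partial f l x; set Hk := hessian f x k l; set Hl := hessian f x l l.
  move=> h1 h2.
  have -> : (p2 - p1) * s - s ^+ 2 * Hk = s * (p2 - p1 - s * Hk) by ring.
  rewrite normrM gtr0_norm // expr2 mulrCA ler_pM2l //.
  have -> : p2 - p1 - s * Hk = (p2 - p3 - (s * Hk + t * Hl)) - (p1 - p3 - t * Hl).
    by ring.
  rewrite (le_trans (ler_normB _ _)) // (le_trans (lerD h2 h1)) //.
  rewrite -mulrDr (le_trans (ler_wpM2l (ltW e30) (lerD n1 n2))) //; lra.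
apply/eqP; rewrite -subr_eq0 -normr_le0; apply/ler_addgt0Pr => e e0.
rewrite add0r; have e20 : 0 < e / 2 by rewrite divr_gt0.
have [d d0 dP] := quot _ e20; pose s := d / 2.
have s0 : 0 < s by rewrite divr_gt0.
have sd : s < d by rewrite /s; lra.
have := dP s s0 sd i j; have := dP s s0 sd j i.
have -> : D s j i = D s i j by rewrite /D [x + _ + _]addrAC; ring.
move=> h1 h2; have s20 : 0 < s ^+ 2 by rewrite exprn_gt0.
rewrite -(ler_pM2l s20) -[X in X * `|_|](gtr0_norm s20) -normrM.
have -> : s ^+ 2 * (hessian f x j i - hessian f x i j) =
  (D s i j - s ^+ 2 * hessian f x i j) - (D s i j - s ^+ 2 * hessian f x j i) by ring.
rewrite (le_trans (ler_normB _ _)) // (le_trans (lerD h2 h1)) //; lra.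
Qed.

(** The mean value theorem is applied on [[0, 1]] to [f] along the segment minus its quadratic
    model. The derivative of this difference is controlled by the first-order expansion of the
    partial derivatives. *)
Lemma taylor2 e : 0 < e -> exists2 d, 0 < d & forall u, `|u| < d ->
  `|f (x + u) - f x - grad f x u - (u^T *m hessian f x *m u) 0 0 / 2|
    <= e * `|u| ^+ 2.
Proof.
move=> e0; have e10 : 0 < e / N.+1%:R by rewrite divr_gt0.
have [d d0 dP] := partial_frechet e10; exists d => // u ud.
set Q := (u^T *m _ *m u) 0 0; set L := grad f x u.
have su (s : R) : s \in `[0, 1] -> `|s *: u| < d.
  rewrite in_itv /= => /andP [s0 s1]; rewrite normrZ ger0_norm //.
  by apply: le_lt_trans ud; rewrite ler_piMl.
have dl (s : R) : s \in `[0, 1] ->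
    is_derive s 1 (fun s => f (x + s *: u)) (grad f (x + s *: u) u).
  move=> /su /dP [As _].
  have oA' : open_nbhs (x + s *: u) A by case: oA.
  have h := C1_is_derive u oA' C1f.
  rewrite -(@derive_val _ _ _ _ _ _ _ h); apply: is_derive_line.
  exact: ex_derive.
pose k s := f (x + s *: u) - (s * L + s ^+ 2 * (Q / 2)).
pose dk s := grad f (x + s *: u) u - (L + s * Q).
have kP (s : R) : s \in `[0, 1] -> is_derive s 1 k (dk s).
  move=> /dl h; apply: is_deriveB.
  have -> : (fun s => s * L + s ^+ 2 * (Q / 2)) =
      horner (L%:P * 'X + (Q / 2)%:P * 'X ^+ 2).
    by apply/funext => z; rewrite !hornerE /=; ring.
  have := is_derive_poly (L%:P * 'X + (Q / 2)%:P * 'X ^+ 2) s.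
  have -> : (L%:P * 'X + (Q / 2)%:P * 'X ^+ 2)^`().[s] = L + s * Q.
    by rewrite !poly.derivE !hornerE /=; field.
  by [].
have kd (s : R) : s \in `]0, 1[ -> is_derive s 1 k (dk s).
  by move=> ss; apply/kP/subset_itv_oo_cc.
have kc : {within `[0, 1], continuous k}.
  by apply: derivable_within_continuous => s /kP h; exact: ex_derive.
have [s s01 kE] := MVT_segment ler01 kd kc.
have -> : f (x + u) - f x - L - Q / 2 = dk s.
  transitivity (k 1 - k 0); first by rewrite /k scale1r scale0r addr0; field.
  by rewrite [LHS]kE subr0 mulr1.
rewrite /dk.
have [_ hp] := dP _ (su _ s01).
have -> : grad f (x + s *: u) u - (L + s * Q) = \sum_i u i 0 *
    (partial f i (x + s *: u) - partial f i x - \sum_j (s *: u) j 0 * hessian f x j i).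
  rewrite opprD addrA /L /grad -sumrB.
  have -> : s * Q = \sum_i u i 0 * (\sum_j (s *: u) j 0 * hessian f x j i).
    rewrite /Q mxE mulr_sumr; apply: eq_bigr => i _.
    rewrite mxE mulrA [_ * u i 0]mulrC; congr (_ * _); rewrite mulr_sumr.
    by apply: eq_bigr => j _; rewrite !mxE mulrA.
  by rewrite -sumrB; apply: eq_bigr => i _; rewrite !mulrBr.
apply: (le_trans (ler_norm_sum _ _ _)).
apply: (@le_trans _ _ (\sum_(i < N) e / N.+1%:R * `|u| ^+ 2)).
  apply: ler_sum => i _; rewrite normrM expr2 mulrA mulrC.
  rewrite ler_pM // ?le_coord_norm // (le_trans (hp i)) // ler_wpM2l ?(ltW e10) //.
  move: s01; rewrite in_itv /= => /andP [s0 s1]; rewrite normrZ ger0_norm //.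
  by rewrite ler_piMl.
rewrite sumr_const card_ord -mulrnAl ler_wpM2r ?exprn_ge0 //.
rewrite -mulr_natr -mulrA -[leRHS]mulr1 ler_wpM2l ?(ltW e0) //.
by rewrite mulrC ler_pdivrMr // mul1r ler_nat.
Qed.

End SecondOrder.
End Differentiability.

(** * The Laplace method for lattice sums *)

Section QuadraticForms.
Variable R : realType.

Lemma qformZ n (A : 'M[R]_n) (c : R) x : qform A (c *: x) = c ^+ 2 * qform A x.
Proof.
have trZ : (c *: x)^T = c *: x^T by apply/matrixP => i j; rewrite !mxE.
by rewrite /qform trZ -scalemxAr -!scalemxAl mxE [X in _ * X]mxE mulrA expr2.
Qed.

Lemma qformZl n (A : 'M[R]_n) (c : R) x : qform (c *: A) x = c * qform A x.
Proof. by rewrite /qform -scalemxAr -scalemxAl mxE. Qed.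

Lemma qformD n (A : 'M[R]_n) x y : A^T = A ->
  qform A (x + y) = qform A x + 2 * (x^T *m A *m y) 0 0 + qform A y.
Proof.
move=> sA; have trD : (x + y)^T = x^T + y^T by apply/matrixP => i j; rewrite !mxE.
rewrite /qform trD !mulmxDl !mulmxDr.
have -> : y^T *m A *m x = (x^T *m A *m y)^T by rewrite !trmx_mul trmxK sA mulmxA.
rewrite mxE [X in X + _]mxE [X in _ + X]mxE [X in _ + (X + _)]mxE; ring.
Qed.

Lemma qform0 n (A : 'M[R]_n) : qform A 0 = 0.
Proof. by rewrite /qform mulmx0 mxE. Qed.

Lemma posdef_ge0 n (A : 'M[R]_n) x : posdef A -> 0 <= qform A x.
Proof.
by move=> pA; have [->|x0] := eqVneq x 0; rewrite ?qform0 // ltW // pA.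
Qed.

Lemma posdefZ n (A : 'M[R]_n) c : 0 < c -> posdef A -> posdef (c *: A).
Proof. by move=> c0 pA x x0; rewrite qformZl mulr_gt0 // pA. Qed.

(** The determinant is the product of the successive pivots, all of them positive. *)
Lemma posdef_det_gt0 n (A : 'M[R]_n) : A^T = A -> posdef A -> 0 < \det A.
Proof.
elim: n A => [|n IH] A sA pA; first by rewrite det_mx00.
rewrite (@det_schur _ n A pA) mulr_gt0 ?(@posdef_pivot _ n A pA) //.
by apply: IH; [exact: schur_sym|exact: schur_posdef].
Qed.

(* If [qform A x = 0] then [A x = 0], since [qform A] is minimal at [x]. *)
Lemma possemidef_posdef n (A : 'M[R]_n) : A^T = A -> (forall x, 0 <= qform A x) ->
  \det A != 0 -> posdef A.
Proof.
move=> sA psd dA x x0; rewrite lt_neqAle psd andbT eq_sym.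
apply: contra x0 => /eqP qx.
have lin (y : 'cV[R]_n) : (x^T *m A *m y) 0 0 = 0.
  set b := (_ *m y) 0 0; apply/eqP/negPn/negP => b0.
  have q0 s : 0 <= 2 * s * b + s ^+ 2 * qform A y.
    have := psd (x + s *: y).
    by rewrite (qformD _ _ sA) qx add0r qformZ -scalemxAr mxE -/b mulrA.
  have qy0 := psd y.
  (* The vertex of the parabola is [- b / q], where [q] may be 0; with [q + 1] in the denominator
     the value is still negative. *)
  have := q0 (- b / (qform A y + 1)).
  have qy1 : 0 < qform A y + 1 by rewrite ltr_wpDl.
  set q := qform A y in qy0 qy1 *.
  have -> : 2 * (- b / (q + 1)) * b + (- b / (q + 1)) ^+ 2 * q =
      - (b ^+ 2 * (q + 2) / (q + 1) ^+ 2) by field; rewrite gt_eqF.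
  rewrite oppr_ge0 leNgt divr_gt0 ?exprn_gt0 // mulr_gt0 ?exprn_even_gt0 //.
  by rewrite ltr_wpDl.
have xA : x^T *m A = 0.
  apply/matrixP => i j; rewrite (ord1 i) [RHS]mxE -(lin (delta_mx j 0)).
  by rewrite -colE [RHS]mxE.
have : x^T = 0.
  have uA : A \in unitmx by rewrite unitmxE unitfE.
  by rewrite -(mulmxK uA x^T) xA mul0mx.
by move/(congr1 trmx); rewrite trmxK trmx0 => ->.
Qed.

Lemma norm_mulmx_le m n (A : 'M[R]_(m, n)) :
  exists2 C, 0 < C & forall x : 'cV[R]_n, `|A *m x| <= C * `|x|.
Proof.
exists (n%:R * `|A| + 1) => [|x]; first by rewrite ltr_wpDl // mulr_ge0.
apply: norm_le_coord => [|i j]; first by rewrite mulr_ge0 // addr_ge0 // mulr_ge0.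
rewrite mxE (le_trans (ler_norm_sum _ _ _)) //.
apply: (@le_trans _ _ (\sum_(k < n) `|A| * `|x|)).
  by apply: ler_sum => k _; rewrite normrM ler_pM // le_coord_norm.
by rewrite sumr_const card_ord -[leLHS]mulr_natl mulrDl mulrA lerDl mul1r.
Qed.

Lemma qform_upper n (A : 'M[R]_n) :
  exists2 C, 0 < C & forall x, `|qform A x| <= C * `|x| ^+ 2.
Proof.
have [C C0 CP] := norm_mulmx_le A.
exists (n%:R * C + 1) => [|x]; first by rewrite ltr_wpDl // mulr_ge0 // ltW.
rewrite /qform -mulmxA mxE (le_trans (ler_norm_sum _ _ _)) //.
apply: (@le_trans _ _ (\sum_(k < n) `|x| * (C * `|x|))).
  apply: ler_sum => k _; rewrite normrM mxE ler_pM ?le_coord_norm //.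
  by rewrite (le_trans _ (CP x)) // le_coord_norm.
rewrite sumr_const card_ord -[leLHS]mulr_natl mulrDl mul1r.
by rewrite [`|x| * _]mulrCA -expr2 mulrA lerDl exprn_ge0.
Qed.

(* [x i = w^T A x] for [w = A^-1 e_i], so the bound is the Cauchy-Schwarz
   inequality for [A]. *)
Lemma qform_lower n (A : 'M[R]_n) : A^T = A -> posdef A ->
  exists2 C, 0 < C & forall x, `|x| ^+ 2 <= C * qform A x.
Proof.
move=> sA pA; have uA : A \in unitmx.
  by rewrite unitmxE unitfE gt_eqF // posdef_det_gt0.
pose w i : 'cV[R]_n := invmx A *m delta_mx i 0.
have S0 : 0 <= \sum_i qform A (w i) by apply: sumr_ge0 => i _; exact: posdef_ge0.
exists (\sum_i qform A (w i) + 1) => [|x]; first by rewrite ltr_wpDl.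
have qx := posdef_ge0 x pA; set C := _ + 1.
have C0 : 0 <= C by rewrite addr_ge0.
suff : `|x| <= Num.sqrt (C * qform A x).
  move=> h; rewrite -(sqr_sqrtr (mulr_ge0 C0 qx)) ler_sqr ?nnegrE ?sqrtr_ge0 //.
apply: norm_le_coord => [|i j]; first exact: sqrtr_ge0.
rewrite (ord1 j) -sqrtr_sqr ler_sqrt ?mulr_ge0 //.
have wne : w i != 0.
  apply/eqP => /(congr1 (mulmx A)); rewrite mulmxA mulmxV // mul1mx mulmx0.
  by move/matrixP => /(_ i 0) /eqP; rewrite !mxE !eqxx oner_eq0.
have qw : 0 < qform A (w i) by apply: pA.
have xw : (x^T *m A *m w i) 0 0 = x i 0.
  by rewrite /w -mulmxA mulKVmx // -colE !mxE.
(* This is the point of the line through [x] in the direction [w i] at which the form is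
   smallest. *)
have := posdef_ge0 (x + (- x i 0 / qform A (w i)) *: w i) pA.
rewrite (qformD _ _ sA) qformZ -scalemxAr mxE xw.
have -> : qform A x + 2 * (- x i 0 / qform A (w i) * x i 0) +
    (- x i 0 / qform A (w i)) ^+ 2 * qform A (w i) =
    qform A x - x i 0 ^+ 2 / qform A (w i) by field; rewrite gt_eqF.
rewrite subr_ge0 ler_pdivrMr // mulrC => /le_trans; apply.
rewrite ler_wpM2r // /C (bigD1 i) //= -addrA lerDl addr_ge0 // sumr_ge0 // => k _.
exact: posdef_ge0.
Qed.

Lemma gauss_cstZ n (A : 'M[R]_n) c : 0 < c ->
  gauss_cst (c *: A) = Num.sqrt c^-1 ^+ n * gauss_cst A.
Proof.
move=> c0; rewrite /gauss_cst detZ.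
have -> : Num.sqrt c^-1 ^+ n = Num.sqrt (c^-1 ^+ n).
  elim: n A => [|n IH] A; first by rewrite !expr0 sqrtr1.
  by rewrite !exprS sqrtrM ?invr_ge0 ?(ltW c0) // (IH 0).
rewrite -sqrtrM ?exprn_ge0 ?invr_ge0 ?(ltW c0) //.
by rewrite invfM exprVn mulrCA.
Qed.

End QuadraticForms.

Lemma ler_sum_subseq (R : realType) (T : eqType) (s1 s2 : seq T) (P : pred T)
    (F : T -> R) : uniq s1 -> uniq s2 -> {in s1, forall k, P k -> k \in s2} ->
  (forall k, 0 <= F k) -> \sum_(k <- s1 | P k) F k <= \sum_(k <- s2 | P k) F k.
Proof.
move=> u1 u2 s12 F0; rewrite -big_filter -[leRHS]big_filter.
have uf : uniq [seq k <- s1 | P k] by rewrite filter_uniq.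
have /(perm_big _) -> /= : perm_eq [seq k <- s2 | P k]
    ([seq k <- s1 | P k] ++ [seq k <- s2 | P k & k \notin s1]).
  apply: uniq_perm; rewrite ?filter_uniq // ?cat_uniq ?filter_uniq ?andbT ?uf //=.
    apply/hasPn => k; rewrite !mem_filter => /andP [/andP [_ ks] _].
    by rewrite (negPf ks) andbF.
  move=> k; rewrite mem_cat !mem_filter.
  case Pk: (P k) => //=; case ks1 : (k \in s1) => //=.
  by rewrite (s12 k ks1 Pk).
by rewrite big_cat /= lerDl sumr_ge0.
Qed.

(** * Comparison with Gaussian sums *)

Section Laplace.
Variables (R : realType) (r : nat) (M : 'M[R]_r).
Hypotheses (sM : M^T = M) (pM : posdef M).
Let q := qform M.
Let G c := gauss_cst (c *: M).

(** The mesh is [h = 1 / sqrt n], because [n q (t + k / n) = q (sqrt n t + k / sqrt n)]. Stating the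
    bounds for finite sequences keeps the later estimates within finite real sums. *)
Lemma gauss_sum_nat c e : 0 < c -> 0 < e -> \forall n \near \oo, forall t : 'cV[R]_r,
  (forall s : seq 'cV[int]_r, uniq s ->
    \sum_(k <- s) expR (- (n%:R * c * q (t + n%:R^-1 *: map_mx intr k)))
      <= Num.sqrt n%:R ^+ r * (G c + e)) /\
  (exists2 s : seq 'cV[int]_r, uniq s & Num.sqrt n%:R ^+ r * (G c - e) <=
    \sum_(k <- s) expR (- (n%:R * c * q (t + n%:R^-1 *: map_mx intr k)))).
Proof.
move=> c0 e0.
have scM : (c *: M)^T = c *: M by rewrite linearZ /= sM.
(* The slack between [e / 2] and [e] gives the strict inequality that extracts a finite partial sum
   from the supremum. *)
have e20 : 0 < e / 2 by rewrite divr_gt0.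
have [h0 h00 hP] := gauss_sum_cvg scM (posdefZ c0 pM) e20.
near=> n => t.
have n0 : 0 < n%:R :> R by rewrite ltr0n; near: n; exists 1%N.
have sn0 : 0 < Num.sqrt n%:R :> R by rewrite sqrtr_gt0.
have nh : (Num.sqrt n%:R)^-1 < h0.
  rewrite -[ltRHS]invrK ltf_pV2 ?posrE ?invr_gt0 //.
  rewrite -[ltLHS]ger0_norm ?invr_ge0 ?(ltW h00) // -sqrtr_sqr ltr_sqrt //.
  near: n; exists (Num.truncn (h0^-1 ^+ 2)).+1 => // m /= hm.
  apply: (lt_le_trans (truncnS_gt _)); by rewrite ler_nat.
have hn0 : 0 < (Num.sqrt n%:R)^-1 :> R by rewrite invr_gt0.
have := hP _ (Num.sqrt n%:R *: t) hn0 nh.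
pose E (k : 'cV[int]_r) := expR (- (n%:R * c * q (t + n%:R^-1 *: map_mx intr k))).
have -> : gauss_sum (c *: M) (Num.sqrt n%:R)^-1 (Num.sqrt n%:R *: t) =
    (\esum_(k in [set: 'cV[int]_r]) (E k)%:E)%E.
  apply: eq_esum => k _; rewrite /E; congr (expR (- _))%:E.
  have -> : Num.sqrt n%:R *: t + (Num.sqrt n%:R)^-1 *: map_mx intr k =
     Num.sqrt n%:R *: (t + n%:R^-1 *: map_mx intr k).
    rewrite scalerDr scalerA; congr (_ + _ *: _).
    have -> : n%:R^-1 = (Num.sqrt n%:R)^-1 ^+ 2 :> R.
      by rewrite exprVn sqr_sqrtr // ltW.
    by rewrite expr2 mulrA divff ?gt_eqF // mul1r.
  by rewrite qformZl qformZ sqr_sqrtr ?(ltW n0) // mulrCA mulrA.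
have E0 k : 0 <= E k by exact: expR_ge0.
set J := esum _ _; set w := Num.sqrt n%:R ^+ r.
have w0 : 0 < w by rewrite exprn_gt0.
rewrite exprVn -/w; move=> /andP [l u].
have Jfin : J \is a fin_num.
  rewrite ge0_fin_numE; last by apply: esum_ge0 => k _; rewrite lee_fin.
  rewrite ltey; apply/eqP => Joo; move: u; rewrite Joo gt0_muley ?lte_fin ?invr_gt0 //.
have lR : w * (G c - e / 2) <= fine J.
  move: l; rewrite -(fineK Jfin) -EFinM lee_fin => l.
  by rewrite -ler_pdivlMl.
have uR : fine J <= w * (G c + e / 2).
  move: u; rewrite -(fineK Jfin) -EFinM lee_fin => u.
  by rewrite -ler_pdivrMl.
split.
  move=> s us; apply: (@le_trans _ _ (fine J)).
    rewrite -lee_fin fineK //; apply: esum_ge.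
    exists [set` s]; first by split=> //; exact: finite_seq.
    by rewrite -fsbig_seq // sumEFin.
  apply: (le_trans uR); rewrite ler_pM2l //; lra.
have Jlt : ((w * (G c - e))%:E < J)%E.
  rewrite -(fineK Jfin) lte_fin (lt_le_trans _ lR) // ltr_pM2l //; lra.
have /ereal_sup_gt [_ [A [fA _] <-] wA] := Jlt.
have /finite_seqP [sA AE] := fA; exists (undup sA); first exact: undup_uniq.
have AE' : A = [set` undup sA].
  by rewrite AE; apply/seteqP; split=> k /=; rewrite mem_undup.
by move: wA; rewrite AE' -fsbig_seq ?undup_uniq // sumEFin lte_fin => /ltW.
Unshelve. all: by end_near. Qed.

Lemma gauss_cst_continuous : {for 1, continuous G}.
Proof.
have cf : {for 1, continuous (fun c : R => Num.sqrt c^-1 ^+ r * gauss_cst M)}.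
  apply: cvgM; last exact: cvg_cst.
  apply: (@cvg_comp _ _ _ (fun c : R => Num.sqrt c^-1) (fun z => z ^+ r)); last first.
    exact: exprn_continuous.
  apply: (@cvg_comp _ _ _ (fun c : R => c^-1) Num.sqrt); last exact: sqrt_continuous.
  by apply: inv_continuous; exact: oner_neq0.
have GE c : 0 < c -> G c = Num.sqrt c^-1 ^+ r * gauss_cst M by exact: gauss_cstZ.
rewrite /prop_for /continuous_at GE ?ltr01 //.
apply: cvg_trans cf; apply: near_eq_cvg; near=> c; rewrite GE //.
by near: c; apply: lt_nbhsr; exact: ltr01.
Unshelve. all: by end_near. Qed.

(** The two expressions in [e] are the upper and lower bounds that arise in [laplace_sum]; both tend
    to [rho * G 1] as [e] tends to 0. *)
Lemma laplace_eps rho eta : 0 < eta -> exists e, [/\ 0 < e, e <= 1 / 2,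
  rho * (1 + e) * (G (1 - e) + e) + e <= rho * G 1 + eta &
  rho * G 1 - eta <= rho * (1 - e) * (G (1 + e) - 2 * e) - e].
Proof.
move=> eta0.
have id0 : (fun e : R => e) @ 0 --> (0 : R) by exact: cvg_id.
have G1 (c : R) : (fun e => G (1 + c * e)) @ 0 --> G 1.
  apply: (@cvg_comp _ _ _ (fun e : R => 1 + c * e) G); last exact: gauss_cst_continuous.
  have h : (fun e : R => 1 + c * e) @ 0 --> 1 + c * 0.
    by apply: cvgD; [exact: cvg_cst|apply: cvgM; [exact: cvg_cst|exact: id0]].
  by rewrite mulr0 addr0 in h.
have up : (fun e => rho * (1 + e) * (G (1 + (-1) * e) + e) + e) @ 0 --> rho * G 1.
  have -> : rho * G 1 = rho * (1 + 0) * (G 1 + 0) + 0 by ring.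
  apply: cvgD; last exact: id0.
  apply: cvgM; last by apply: cvgD; [exact: G1|exact: id0].
  by apply: cvgM; [exact: cvg_cst|apply: cvgD; [exact: cvg_cst|exact: id0]].
have lo : (fun e => rho * (1 - e) * (G (1 + 1 * e) - 2 * e) - e) @ 0 --> rho * G 1.
  have -> : rho * G 1 = rho * (1 - 0) * (G 1 - 2 * 0) - 0 by ring.
  apply: cvgB; last exact: id0.
  apply: cvgM; last first.
    by apply: cvgB; [exact: G1|apply: cvgM; [exact: cvg_cst|exact: id0]].
  by apply: cvgM; [exact: cvg_cst|apply: cvgB; [exact: cvg_cst|exact: id0]].
have /nbhs_ballP [d /= d0 dP] : \forall e \near (0 : R),
    `|rho * G 1 - (rho * (1 + e) * (G (1 + (-1) * e) + e) + e)| <= eta /\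
    `|rho * G 1 - (rho * (1 - e) * (G (1 + 1 * e) - 2 * e) - e)| <= eta.
  near=> e; split; near: e; [move/cvgrPdist_le : up|move/cvgrPdist_le : lo];
    exact.
pose e := Num.min (1 / 2) (d / 2).
have e0 : 0 < e by rewrite lt_min !divr_gt0.
have [] := dP e.
  rewrite -ball_normE /ball_ /= sub0r normrN gtr0_norm // gt_min.
  by apply/orP; right; lra.
rewrite mulN1r mul1r !ler_distl => /andP [u1 u2] /andP [l1 l2].
exists e; split=> //; first by rewrite ge_min lexx.
  by rewrite -lerBlDr.
by rewrite lerBlDr.
Unshelve. all: by end_near. Qed.

Section Sum.
Variables (s : nat -> seq 'cV[int]_r) (t : nat -> 'cV[R]_r).
Variables (W : nat -> 'cV[int]_r -> R) (rho kap C : R).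
Let Q n k := q (t n + n%:R^-1 *: map_mx intr k).
Hypotheses (us : forall n, uniq (s n)) (rho0 : 0 < rho) (kap0 : 0 < kap) (C0 : 0 < C).
Hypothesis near_sum : forall e, 0 < e -> e <= 1 / 2 -> exists2 d, 0 < d &
  \forall n \near \oo, forall k, Q n k < d -> [/\ k \in s n,
     rho * (1 - e) * expR (- (n%:R * (1 + e) * Q n k)) <= W n k &
     W n k <= rho * (1 + e) * expR (- (n%:R * (1 - e) * Q n k))].
Hypothesis far_sum : forall e, 0 < e -> \forall n \near \oo,
  forall k, k \in s n -> `|W n k| <= C * expR (- (n%:R * kap * Q n k) + e * n%:R).

Lemma expR_decay c : 0 < c -> forall e, 0 < e ->
  \forall n \near \oo, expR (- (n%:R * c)) <= e :> R.
Proof.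
move=> c0 e e0; near=> n.
rewrite -[leRHS](@lnK R) ?posrE // ler_expR lerNl -ler_pdivrMr //.
near: n; exists (Num.truncn (`|- ln e / c|)).+1 => // m /= hm.
rewrite (le_trans (ler_norm _)) // (le_trans (ltW (truncnS_gt _))) // ler_nat.
exact: hm.
Unshelve. all: by end_near. Qed.

Lemma gauss_upper c e : 0 < c -> 0 < e -> \forall n \near \oo,
  forall s' : seq 'cV[int]_r, uniq s' ->
    \sum_(k <- s') expR (- (n%:R * c * Q n k)) <= Num.sqrt n%:R ^+ r * (G c + e).
Proof.
move=> c0 e0; apply: filterS (gauss_sum_nat c0 e0) => n h s' us'.
by have [hU _] := h (t n); exact: hU.
Qed.

Lemma gauss_lower c e : 0 < c -> 0 < e -> \forall n \near \oo,
  exists2 s' : seq 'cV[int]_r, uniq s' &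
    Num.sqrt n%:R ^+ r * (G c - e) <= \sum_(k <- s') expR (- (n%:R * c * Q n k)).
Proof.
move=> c0 e0; apply: filterS (gauss_sum_nat c0 e0) => n h.
by have [_ hL] := h (t n); exact: hL.
Qed.

(** [W n k] plays the role of the summand divided by [c n * exp (n phi(xhat))]. Where [Q n k < d],
    it is squeezed between Gaussians with the exponents scaled by [1 + e] and [1 - e]; the remaining
    terms are of lower order. *)
Lemma laplace_sum eta : 0 < eta -> \forall n \near \oo,
  `|\sum_(k <- s n) W n k - Num.sqrt n%:R ^+ r * (rho * G 1)|
    <= eta * Num.sqrt n%:R ^+ r.
Proof.
move=> eta0; have [e [e0 e12 upe loe]] := laplace_eps rho eta0.
have [d d0 nearP] := near_sum e0 e12.
have e2 : 0 < kap * d / 4 by rewrite divr_gt0 // mulr_gt0.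
have k2 : 0 < kap / 2 by rewrite divr_gt0.
have c1 : 0 < 1 - e by lra.
have c2 : 0 < 1 + e by lra.
have half0 : 0 < 1 / 2 :> R by lra.
have d2 : 0 < d / 2 by rewrite divr_gt0.
(* [B1] and [B2] bound the Gaussian sums over the far terms, up to the power of [n]; the
   exponentially small factors are compared with [e / B1] and [e / B2]. *)
pose B1 := C * (`|G (kap / 2)| + 1).
have B10 : 0 < B1 by rewrite mulr_gt0 // ltr_wpDl.
pose B2 := `|G (1 / 2)| + 1; have B20 : 0 < B2 by rewrite ltr_wpDl.
have Q0 n k : 0 <= Q n k by exact: posdef_ge0.
near=> n.
have nP : forall k, Q n k < d -> [/\ k \in s n,
     rho * (1 - e) * expR (- (n%:R * (1 + e) * Q n k)) <= W n k &
     W n k <= rho * (1 + e) * expR (- (n%:R * (1 - e) * Q n k))].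
  by near: n.
have fP : forall k, k \in s n ->
    `|W n k| <= C * expR (- (n%:R * kap * Q n k) + kap * d / 4 * n%:R).
  by near: n; exact: far_sum.
have U1 : forall s' : seq 'cV[int]_r, uniq s' ->
    \sum_(k <- s') expR (- (n%:R * (1 - e) * Q n k))
      <= Num.sqrt n%:R ^+ r * (G (1 - e) + e).
  by near: n; exact: gauss_upper.
have U2 : forall s' : seq 'cV[int]_r, uniq s' ->
    \sum_(k <- s') expR (- (n%:R * (kap / 2) * Q n k))
      <= Num.sqrt n%:R ^+ r * (G (kap / 2) + 1).
  by near: n; exact: gauss_upper.
have U3 : forall s' : seq 'cV[int]_r, uniq s' ->
    \sum_(k <- s') expR (- (n%:R * (1 / 2) * Q n k))
      <= Num.sqrt n%:R ^+ r * (G (1 / 2) + 1).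
  by near: n; exact: gauss_upper.
have [s0 us0 L0] : exists2 s' : seq 'cV[int]_r, uniq s' &
    Num.sqrt n%:R ^+ r * (G (1 + e) - e)
      <= \sum_(k <- s') expR (- (n%:R * (1 + e) * Q n k)).
  by near: n; exact: gauss_lower.
have D1 : expR (- (n%:R * (kap * d / 4))) <= e / B1.
  by near: n; apply: expR_decay => //; exact: divr_gt0.
have D2 : expR (- (n%:R * (d / 2))) <= e / B2.
  by near: n; apply: expR_decay => //; exact: divr_gt0.
set w := Num.sqrt n%:R ^+ r in U1 U2 U3 L0 *.
have w0 : 0 <= w by rewrite exprn_ge0 // sqrtr_ge0.
have n0 : 0 <= n%:R :> R by [].
have far : `|\sum_(k <- s n | ~~ (Q n k < d)) W n k| <= e * w.
  apply: (le_trans (ler_norm_sum _ _ _)).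
  apply: (@le_trans _ _ (\sum_(k <- s n | ~~ (Q n k < d))
      C * expR (- (n%:R * (kap * d / 4))) * expR (- (n%:R * (kap / 2) * Q n k)))).
    rewrite big_seq_cond [leRHS]big_seq_cond; apply: ler_sum => k /andP [ks].
    rewrite -leNgt => dQ; rewrite (le_trans (fP k ks)) // -[leRHS]mulrA ler_pM2l //.
    rewrite -expRD ler_expR.
    have : n%:R * (kap / 2 * d) <= n%:R * (kap / 2 * Q n k).
      by rewrite ler_wpM2l // ler_wpM2l // ltW.
    by move: (n%:R) (Q n k) => m z; lra.
  rewrite -mulr_sumr.
  apply: (@le_trans _ _ (C * (e / B1) * (w * (`|G (kap / 2)| + 1)))).
    rewrite ler_pM ?mulr_ge0 ?expR_ge0 ?(ltW C0) ?ler_wpM2l ?(ltW C0) //.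
      by apply: sumr_ge0 => k _; exact: expR_ge0.
    apply: (@le_trans _ _ (\sum_(k <- s n) expR (- (n%:R * (kap / 2) * Q n k)))).
      rewrite [leRHS](bigID (fun k => ~~ (Q n k < d))) /= lerDl.
      by apply: sumr_ge0 => k _; exact: expR_ge0.
    by rewrite (le_trans (U2 _ (us n))) // ler_wpM2l // lerD2r ler_norm.
  rewrite le_eqVlt; apply/orP; left; apply/eqP; rewrite /B1; field.
  by rewrite !gt_eqF // ltr_wpDl.
have nearU : \sum_(k <- s n | Q n k < d) W n k <= rho * (1 + e) * (w * (G (1 - e) + e)).
  apply: (@le_trans _ _ (\sum_(k <- s n | Q n k < d)
      rho * (1 + e) * expR (- (n%:R * (1 - e) * Q n k)))).
    by apply: ler_sum => k /nP [].
  rewrite -mulr_sumr ler_wpM2l ?mulr_ge0 ?(ltW rho0) ?(ltW c2) //.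
  apply: le_trans (U1 _ (us n)); rewrite [leRHS](bigID (fun k => Q n k < d)) /= lerDl.
  by apply: sumr_ge0 => k _; exact: expR_ge0.
(* The sequence [s0] that attains the lower bound is included in [s n] only where [Q < d]. Its other
   terms are negligible since there [(1 + e) Q >= d / 2 + Q / 2]; removing them costs a second
   [e]. *)
have far0 : \sum_(k <- s0 | ~~ (Q n k < d)) expR (- (n%:R * (1 + e) * Q n k)) <= e * w.
  apply: (@le_trans _ _ (\sum_(k <- s0 | ~~ (Q n k < d))
      expR (- (n%:R * (d / 2))) * expR (- (n%:R * (1 / 2) * Q n k)))).
    apply: ler_sum => k; rewrite -leNgt => dQ; rewrite -expRD ler_expR.
    have : n%:R * d <= n%:R * Q n k by rewrite ler_wpM2l.
    have : 0 <= n%:R * (e * Q n k) by rewrite !mulr_ge0 // ltW.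
    by move: (n%:R) (Q n k) => m z; lra.
  rewrite -mulr_sumr.
  apply: (@le_trans _ _ (e / B2 * (w * (`|G (1 / 2)| + 1)))).
    rewrite ler_pM ?expR_ge0 //.
      by apply: sumr_ge0 => k _; exact: expR_ge0.
    apply: (@le_trans _ _ (\sum_(k <- s0) expR (- (n%:R * (1 / 2) * Q n k)))).
      rewrite [leRHS](bigID (fun k => ~~ (Q n k < d))) /= lerDl.
      by apply: sumr_ge0 => k _; exact: expR_ge0.
    by rewrite (le_trans (U3 _ us0)) // ler_wpM2l // lerD2r ler_norm.
  rewrite le_eqVlt; apply/orP; left; apply/eqP; rewrite -/B2; field.
  by rewrite gt_eqF.
have nearL : rho * (1 - e) * (w * (G (1 + e) - 2 * e))
    <= \sum_(k <- s n | Q n k < d) W n k.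
  apply: (@le_trans _ _ (\sum_(k <- s n | Q n k < d)
      rho * (1 - e) * expR (- (n%:R * (1 + e) * Q n k)))); last first.
    by apply: ler_sum => k /nP [].
  rewrite -mulr_sumr ler_wpM2l ?mulr_ge0 ?(ltW rho0) ?(ltW c1) //.
  apply: (@le_trans _ _ (\sum_(k <- s0 | Q n k < d) expR (- (n%:R * (1 + e) * Q n k)))).
    have := L0; rewrite (bigID (fun k => Q n k < d)) /= => L0'.
    have := le_trans L0' (lerD (lexx _) far0).
    move: (\sum_(_ <- _ | _) _) => S; lra.
  by apply: ler_sum_subseq => // k _ /nP [].
rewrite (bigID (fun k => Q n k < d)) /=.
move: far nearU nearL; set S1 := \sum_(_ <- _ | _) _; set S2 := \sum_(_ <- _ | _) _.
rewrite ler_norml => /andP [f1 f2] nU nL.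
have wu := ler_wpM2l w0 upe; have wl := ler_wpM2l w0 loe.
rewrite ler_norml; apply/andP; split; lra.
Unshelve. all: by end_near. Qed.

End Sum.

End Laplace.

(** * Finiteness of the set of lattice points *)

Section LatticePoints.
Variables (R : realType) (m N : nat) (D : 'M[R]_(m, N)) (y : 'cV[R]_m).
Variable K : set 'cV[R]_N.

Lemma finite_int_box (b : nat) :
  finite_set [set z : 'cV[int]_N | forall i, `|z i 0| <= b%:Z].
Proof.
apply: (@sub_finite_set _ _ ((fun f : {ffun 'I_N -> 'I_(2 * b).+1} =>
    \col_i ((f i)%:Z - b%:Z)) @` [set: {ffun 'I_N -> 'I_(2 * b).+1}])); last first.
  exact/finite_image/finite_finset.
move=> z /= zb.
have h i : (absz (z i 0%R + b%:Z)%R < (2 * b).+1)%N.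
  have := zb i; rewrite ler_norml => /andP [z1 z2].
  have z1' : 0 <= z i 0 + b%:Z by rewrite -lerBlDr sub0r.
  rewrite ltnS -lez_nat gez0_abs // mul2n -addnn PoszD lerD2r //.
exists [ffun i => Ordinal (h i)] => //.
apply/matrixP => i j; rewrite !mxE ffunE (ord1 j) /=.
have := zb i; rewrite ler_norml => /andP [z1 z2].
by rewrite gez0_abs ?addrK // -lerBlDr sub0r.
Qed.

Lemma finite_lattice_points n : compact K -> (0 < n)%N ->
  finite_set (lattice_points K D y n).
Proof.
move=> cK n0; have [b [_ bP]] := compact_bounded cK.
have n0' : 0 < n%:R :> R by rewrite ltr0n.
have bK x : K x -> `|x| <= b + 1 by move=> Kx; apply: bP => //; rewrite ltrDl.
pose b' := (Num.truncn (n%:R * (b + 1))).+1.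
apply: sub_finite_set (finite_image (fun z => n%:R^-1 *: map_mx intr z)
  (finite_int_box b')).
move=> x [Kx [z xE] _]; exists z => //= i.
rewrite -(ler_int R) intr_norm.
have -> : (z i 0)%:~R = n%:R * x i 0 :> R.
  by rewrite xE !mxE mulrA divff ?gt_eqF // mul1r.
rewrite normrM gtr0_norm // (le_trans _ (ltW (truncnS_gt _))) //.
by rewrite ler_pM2l // (le_trans _ (bK _ Kx)) // le_coord_norm.
Qed.

End LatticePoints.

Lemma mulmx_continuous (R : realType) m n (A : 'M[R]_(m, n)) :
  forall x, (fun z : 'cV[R]_n => A *m z) @ nbhs x --> A *m x.
Proof.
move=> x; have [C C0 CP] := norm_mulmx_le A.
apply/cvgrPdist_lt => e e0; have eC : 0 < e / C by rewrite divr_gt0.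
near=> z; rewrite -mulmxBr (le_lt_trans (CP _)) // mulrC -ltr_pdivlMr //.
Unshelve. all: by end_near. Qed.

(** * The exponent near the maximizer and far from it *)

Section Expansion.
Variables (R : realType) (m N r : nat) (D : 'M[R]_(m, N)) (y : 'cV[R]_m).
Variables (B : 'M[R]_(N, r)) (K : set 'cV[R]_N) (phi : 'cV[R]_N -> R).
Variable xhat : 'cV[R]_N.
Let H := hessian phi xhat.
Let A := B^T *m - H *m B.
Let M := 2^-1 *: A.
Hypothesis DB : D *m B = 0.
Hypotheses (cK : compact K) (phiK : {within K, continuous phi}).
Hypotheses (Kx : interior K xhat) (Dx : D *m xhat = y).
Hypothesis phi_max : forall x, K x -> D *m x = y -> x <> xhat -> phi x < phi xhat.
Hypothesis phiC2 : C2_near xhat phi.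

Lemma qform_restr t : qform M t = - (qform H (B *m t) / 2).
Proof.
rewrite /M qformZl /A /qform trmx_mul mulmxN mulNmx mulmxN mulNmx mxE !mulmxA.
by rewrite mulrN mulrC.
Qed.

Lemma hessian_restr_sym : A^T = A.
Proof.
have [V oV [C1f C1p]] := phiC2.
have sH : H^T = H by apply: hessian_sym oV C1f C1p.
by rewrite /A !trmx_mul trmxK linearN /= sH mulmxA.
Qed.

(** Since [xhat] is interior to [K], all small multiples of [v] lead to competitors of [xhat], and
    Taylor's formula bounds [s L + s^2 Q / 2] by [e s^2] for small [s], with [e] arbitrary. *)
Lemma second_order_bound v : D *m v = 0 -> grad phi xhat v = 0 /\ qform H v <= 0.
Proof.
move=> Dv; have [V oV [C1f C1p]] := phiC2.
set L := grad _ _ _; set Q := qform _ _.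
have phi_le x : K x -> D *m x = y -> phi x <= phi xhat.
  by move=> hK hD; have [->//|/eqP xne] := eqVneq x xhat; rewrite ltW // phi_max.
have /nbhs_ballP [dK /= dK0 dKP] := Kx.
have v1 : 0 < `|v| + 1 by rewrite ltr_wpDl.
have small e : 0 < e -> exists2 d, 0 < d & forall s, `|s| < d ->
    s * L + s ^+ 2 * (Q / 2) <= e * s ^+ 2.
  move=> e0; have e10 : 0 < e / (`|v| + 1) ^+ 2 by rewrite divr_gt0 // exprn_gt0.
  have [d d0 dP] := taylor2 oV C1f C1p e10.
  exists (Num.min d dK / (`|v| + 1)); first by rewrite divr_gt0 // lt_min d0.
  move=> s sd; have : `|s *: v| < Num.min d dK.
    rewrite normrZ; apply: (le_lt_trans (y := `|s| * (`|v| + 1))).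
      by rewrite ler_wpM2l // lerDl.
    by rewrite -ltr_pdivlMr.
  rewrite lt_min => /andP [h1 h2].
  have := dP _ h1; rewrite gradZ -/L -/(qform _ _) qformZ -/H -/Q.
  have : phi (xhat + s *: v) <= phi xhat.
    apply: phi_le; last by rewrite mulmxDr Dx -scalemxAr Dv scaler0 addr0.
    by apply: dKP; rewrite -ball_normE /ball_ /= opprD addNKr normrN.
  move=> hle; rewrite ler_norml normrZ exprMn real_normK ?num_real // => /andP [lo _].
  have : e / (`|v| + 1) ^+ 2 * (s ^+ 2 * `|v| ^+ 2) <= e * s ^+ 2.
    rewrite -mulrA ler_pM2l // mulrCA -[leRHS]mulr1 ler_wpM2l ?sqr_ge0 //.
    rewrite mulrC ler_pdivrMr ?exprn_gt0 // mul1r.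
    by rewrite ler_sqr ?nnegrE // ?lerDl // ltW.
  move: lo hle; set X := e / _ * _; set P := phi _; lra.
have L0 : L = 0.
  apply/eqP/negPn/negP => Ln0; have [d d0 dP] := small 1 ltr01.
  pose c0 := 1 + `|Q / 2|; have c00 : 0 < c0 by rewrite ltr_wpDr.
  have L0 : 0 < `|L| by rewrite normr_gt0.
  (* At [s = tau * L], for this small real number [tau], the linear gain [tau L^2] exceeds the
     second-order terms, at most [tau^2 L^2 c0], with [tau c0 <= 1 / 2]. *)
  pose tau := Num.min (d / (2 * `|L|)) (1 / (2 * c0)).
  have t0 : 0 < tau by rewrite lt_min !divr_gt0 // mulr_gt0.
  have t1 : tau * (2 * `|L|) <= d.
    by rewrite -ler_pdivlMr ?mulr_gt0 // ge_min lexx.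
  have t2 : tau * (2 * c0) <= 1.
    by rewrite -ler_pdivlMr ?mulr_gt0 // ge_min lexx orbT.
  have sd : `|tau * L| < d.
    by rewrite normrM gtr0_norm //; have : 0 < tau * `|L| := mulr_gt0 t0 L0; lra.
  have := dP _ sd; have L2 : 0 < L ^+ 2 by rewrite exprn_even_gt0.
  have -> : tau * L * L + (tau * L) ^+ 2 * (Q / 2) =
     tau * L ^+ 2 * (1 + tau * (Q / 2)) by ring.
  have -> : 1 * (tau * L) ^+ 2 = tau * L ^+ 2 * tau by ring.
  have tL : 0 < tau * L ^+ 2 by exact: mulr_gt0.
  rewrite (ler_pM2l tL).
  have : tau * - (Q / 2) <= tau * `|Q / 2|.
    by rewrite ler_pM2l // -normrN ler_norm.
  by rewrite /c0 in t2; lra.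
split=> //; suff : Q / 2 <= 0 by lra.
apply/ler_addgt0Pr => e e0; rewrite add0r.
have [d d0 dP] := small e e0; have d20 : 0 < d / 2 by rewrite divr_gt0.
have : `|d / 2| < d by rewrite gtr0_norm //; lra.
move=> /dP; rewrite L0 mulr0 add0r [e * _]mulrC ler_pM2l //.
by rewrite exprn_gt0.
Qed.

Hypothesis detA : \det A != 0.

(** The second-order condition yields a semidefinite form only; the nonzero determinant makes it
    definite. *)
Lemma hessian_restr_posdef : posdef M.
Proof.
apply: posdefZ; first by rewrite invr_gt0.
apply: possemidef_posdef detA; first exact: hessian_restr_sym.
move=> t; have Dt : D *m (B *m t) = 0 by rewrite mulmxA DB mul0mx.
have [_] := second_order_bound Dt.
rewrite /A /qform trmx_mul mulmxN mulNmx mulmxN mulNmx !mulmxA.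
by rewrite [X in _ -> 0 <= X]mxE oppr_ge0.
Qed.

Let sM : M^T = M.
Proof. by rewrite /M linearZ /= hessian_restr_sym. Qed.

Lemma norm_restr_le : exists2 C, 0 < C &
  forall t, `|B *m t| ^+ 2 <= C * qform M t.
Proof.
have [C1 C10 C1P] := norm_mulmx_le B.
have [C2 C20 C2P] := qform_lower sM hessian_restr_posdef.
exists (C1 ^+ 2 * C2) => [|t]; first by rewrite mulr_gt0 // exprn_gt0.
apply: (@le_trans _ _ (C1 ^+ 2 * `|t| ^+ 2)).
  by rewrite -exprMn ler_sqr ?nnegrE ?mulr_ge0 // ltW.
by rewrite -mulrA ler_pM2l ?exprn_gt0.
Qed.

Lemma near_small d : 0 < d -> exists2 e, 0 < e &
  forall t, qform M t < e -> `|B *m t| < d.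
Proof.
move=> d0; have [C C0 CP] := norm_restr_le.
exists (d ^+ 2 / C) => [|t]; first by rewrite divr_gt0 // exprn_gt0.
rewrite ltr_pdivlMr // mulrC => h; have := le_lt_trans (CP t) h.
by rewrite ltr_sqr ?nnegrE // ltW.
Qed.

(** The gradient vanishes on the kernel and the form dominates the squared norm there, so the Taylor
    error is relative to the form itself. *)
Lemma phi_expansion e : 0 < e -> exists2 d, 0 < d & forall t, qform M t < d ->
  `|phi (xhat + B *m t) - phi xhat + qform M t| <= e * qform M t.
Proof.
move=> e0; have [V oV [C1f C1p]] := phiC2.
have [C C0 CP] := norm_restr_le.
have [d1 d10 d1P] := taylor2 oV C1f C1p (divr_gt0 e0 C0).
have [d d0 dP] := near_small d10; exists d => // t /dP /d1P.
have Dt : D *m (B *m t) = 0 by rewrite mulmxA DB mul0mx.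
have [-> _] := second_order_bound Dt.
rewrite subr0 -/(qform _ _) -/H qform_restr => h; apply: (le_trans h).
by rewrite -qform_restr mulrAC ler_pdivrMr // -mulrA ler_pM2l // mulrC.
Qed.

(** Near [xhat] the expansion with relative error [1 / 2] suffices. Elsewhere compactness gives a
    gap [eta] below the maximum, while the form is bounded on [K], so a small multiple of it stays
    below [eta]. *)
Lemma phi_global_bound : exists2 kap, 0 < kap & forall t, K (xhat + B *m t) ->
  phi (xhat + B *m t) - phi xhat <= - (kap * qform M t).
Proof.
have half0 : 0 < 1 / 2 :> R by lra.
have [d d0 dP] := phi_expansion half0.
have [b [_ bP]] := compact_bounded cK.
have [CH CH0 CHP] := qform_upper H.
have qle t : qform M t <= CH * `|B *m t| ^+ 2.
  rewrite qform_restr; have := CHP (B *m t); rewrite ler_norml => /andP [lo _].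
  have : 0 <= CH * `|B *m t| ^+ 2 by rewrite mulr_ge0 ?exprn_ge0 // ltW.
  lra.
(* If [|v| < p], then the form is at most [CH |v|^2 <= CH |v| < d]. *)
pose p := Num.min 1 (d / CH).
have p0 : 0 < p by rewrite lt_min ltr01 divr_gt0.
(* The equation [D x = y] is written as a norm inequality, so that it defines the preimage of a
   closed half-line. *)
pose K' := (K `&` [set x | `|D *m x - y| <= 0]) `&` [set x | p <= `|x - xhat|].
have c1 : continuous (fun x : 'cV[R]_N => `|D *m x - y|).
  move=> x; apply: (@cvg_norm _ _ _ (nbhs x) _ (fun x => D *m x - y)).
  by apply: cvgB; [exact: mulmx_continuous|exact: cvg_cst].
have c2 : continuous (fun x : 'cV[R]_N => `|x - xhat|).
  move=> x; apply: (@cvg_norm _ _ _ (nbhs x) _ (fun x => x - xhat)).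
  by apply: cvgB; [exact: cvg_id|exact: cvg_cst].
have cK' : compact K'.
  apply: compact_closedI.
    apply: compact_closedI => //.
    have -> : [set x | `|D *m x - y| <= 0] =
        (fun x : 'cV[R]_N => `|D *m x - y|) @^-1` [set z | z <= 0] by [].
    by apply: preimage_closed; [move=> x _; exact: c1|exact: closed_le].
  have -> : [set x | p <= `|x - xhat|] =
      (fun x : 'cV[R]_N => `|x - xhat|) @^-1` [set z | p <= z] by [].
  by apply: preimage_closed; [move=> x _; exact: c2|exact: closed_ge].
have [eta eta0 etaP] : exists2 eta, 0 < eta & forall x, K' x ->
    phi x <= phi xhat - eta.
  (* If [K'] is empty, any positive gap will do. *)
  have [[x0 K'x0]|noK'] := pselect (K' !=set0); last first.
    by exists 1 => // x K'x; exfalso; apply: noK'; exists x.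
  have phiK' : {within K', continuous phi}.
    by apply: continuous_subspaceW phiK => x [[]].
  have [z] := compact_EVT_max (ex_intro _ _ K'x0) cK' phiK'.
  rewrite inE => -[[Kz /=]]; rewrite normr_le0 subr_eq0 => /eqP Dz zx zmax.
  exists (phi xhat - phi z).
    rewrite subr_gt0 phi_max // => zE; move: zx.
    by rewrite zE subrr normr0 leNgt p0.
  by move=> x K'x; rewrite subKr; apply: zmax; rewrite inE.
(* On [K] the distance to [xhat] is at most [b']; the 1 is there because [bP] holds for numbers
   strictly greater than [b]. *)
pose b' := `|b| + 1 + `|xhat|.
have b'0 : 0 < b' by rewrite /b' -addrA ltr_wpDl // ltr_pwDl.
have CHb : 0 < CH * b' ^+ 2 by rewrite mulr_gt0 // exprn_gt0.
exists (Num.min (1 / 2) (eta / (CH * b' ^+ 2))).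
  by rewrite lt_min half0 divr_gt0.
move=> t Kt; set v := B *m t in Kt *; set kap := Num.min _ _.
have q0 : 0 <= qform M t by apply/posdef_ge0/hessian_restr_posdef.
have [vp|vp] := ltP `|v| p.
  have qd : qform M t < d.
    apply: (le_lt_trans (qle t)); rewrite -/v.
    have v1 : `|v| <= 1 by rewrite (le_trans (ltW vp)) // ge_min lexx.
    apply: (@le_lt_trans _ _ (CH * `|v|)).
      by rewrite ler_pM2l // expr2 ler_piMl.
    by rewrite mulrC -ltr_pdivlMr // (lt_le_trans vp) // ge_min lexx orbT.
  have := dP _ qd; rewrite -/v ler_norml => /andP [_ hi].
  have : kap * qform M t <= 1 / 2 * qform M t.
    by rewrite ler_wpM2r // ge_min lexx.
  lra.
have Dv : D *m v = 0 by rewrite mulmxA DB mul0mx.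
have K'v : K' (xhat + v).
  split; last by rewrite /= addrAC subrr add0r.
  by split=> //=; rewrite mulmxDr Dv addr0 Dx subrr normr0.
have := etaP _ K'v.
have : kap * qform M t <= eta.
  apply: (@le_trans _ _ (eta / (CH * b' ^+ 2) * (CH * b' ^+ 2))); last first.
    by rewrite divfK // gt_eqF.
  rewrite ler_pM //.
  - by rewrite le_min (ltW half0) ltW // divr_gt0.
  - by rewrite ge_min lexx orbT.
  rewrite (le_trans (qle t)) // ler_pM2l // ler_sqr ?nnegrE // ?(ltW b'0) //.
  have -> : B *m t = (xhat + v) - xhat by rewrite addrAC subrr add0r.
  rewrite (le_trans (ler_normB _ _)) // lerD2r bP //.
  by rewrite (le_lt_trans (ler_norm b)) // ltrDl.
lra.
Qed.

End Expansion.

(** * The sum over the lattice points *)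

Section Main.
Variables (R : realType) (m N r : nat) (D : 'M[R]_(m, N)) (y : 'cV[R]_m).
Variables (B : 'M[int]_(N, r)) (K K1 : set 'cV[R]_N) (phi psi : 'cV[R]_N -> R).
Variables (xhat : 'cV[R]_N) (c : nat -> R) (T : nat -> 'cV[R]_N -> R).
Let BR : 'M[R]_(N, r) := map_mx intr B.
Let X := lattice_points K D y.
Let H := hessian phi xhat.
Let A := BR^T *m - H *m BR.
Hypothesis DB : D *m BR = 0.
Hypothesis B_span : forall x : 'cV[R]_N, D *m x = 0 -> exists t, x = BR *m t.
Hypothesis B_int : forall z : 'cV[int]_N,
  D *m map_mx intr z = 0 -> exists k, z = B *m k.
Hypothesis B_inj : forall t : 'cV[R]_r, BR *m t = 0 -> t = 0.
Hypotheses (cK : compact K) (phiK : {within K, continuous phi}).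
Hypotheses (Kx : interior K xhat) (Dx : D *m xhat = y).
Hypothesis phi_max : forall x, K x -> D *m x = y -> x <> xhat -> phi x < phi xhat.
Hypothesis phiC2 : C2_near xhat phi.
Hypotheses (K1x : nbhs xhat K1) (K1K : K1 `<=` K).
Hypotheses (psiK1 : {within K1, continuous psi}) (psi0 : 0 < psi xhat).
Hypothesis X_ne : forall n, (0 < n)%N -> X n !=set0.
Hypothesis c_gt0 : forall n, (0 < n)%N -> 0 < c n.
Hypothesis T_bigO : exists2 eps : nat -> 'cV[R]_N -> R,
  uniform_littleo X eps (fun n => n%:R) &
  uniform_bigO X T (fun n x => c n * expR (n%:R * phi x + eps n x)).
Hypothesis T_near : exists2 delta : nat -> 'cV[R]_N -> R,
  uniform_littleo (fun n => X n `&` K1) delta (fun=> 1) &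
  \forall n \near \oo, forall x, X n x -> K1 x ->
    T n x = c n * (psi x + delta n x) * expR (n%:R * phi x).
Hypothesis detA : \det A != 0.

Let M := 2^-1 *: A.

(** The base point is any element of [X n], so nothing is known of the position of the lattice
    relative to [xhat]; the Gaussian bounds are uniform in the shift for this reason. *)
Lemma lattice_param : exists (x0 : nat -> 'cV[R]_N) (t : nat -> 'cV[R]_r),
  forall n, (0 < n)%N -> X n (x0 n) /\ x0 n = xhat + BR *m t n.
Proof.
have /boolp.choice [x0 x0P] : forall n, exists x, (0 < n)%N -> X n x.
  by move=> n; case: n => [|n]; [exists 0|have [x Xx] := X_ne (ltn0Sn n); exists x].
have /boolp.choice [t tP] : forall n, exists t, (0 < n)%N -> x0 n = xhat + BR *m t.
  move=> n; have [n0|] := boolP (0 < n)%N; last by exists 0.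
  have [_ _ Dx0] := x0P n n0.
  have /B_span [t tE] : D *m (x0 n - xhat) = 0 by rewrite mulmxBr Dx0 Dx subrr.
  by exists t => _; rewrite -tE addrC subrK.
by exists x0, t => n n0; split; [exact: x0P|exact: tP].
Qed.

Section Param.
Variables (x0 : nat -> 'cV[R]_N) (t : nat -> 'cV[R]_r).
Hypothesis x0P : forall n, (0 < n)%N -> X n (x0 n) /\ x0 n = xhat + BR *m t n.
Let pt n (k : 'cV[int]_r) := x0 n + n%:R^-1 *: (BR *m map_mx intr k).

Lemma ptE n k : (0 < n)%N ->
  pt n k = xhat + BR *m (t n + n%:R^-1 *: map_mx intr k).
Proof.
by move=> n0; rewrite /pt (proj2 (x0P n0)) mulmxDr scalemxAr addrA.
Qed.

Lemma pt_lattice n k : (0 < n)%N -> K (pt n k) -> X n (pt n k).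
Proof.
move=> n0 Kk; have [[_ [z zE] Dx0] _] := x0P n0; split=> //.
  exists (z + B *m k); rewrite /pt zE -map_mxM -scalerDr; congr (_ *: _).
  by apply/matrixP => i j; rewrite !mxE intrD.
by rewrite /pt mulmxDr Dx0 -scalemxAr mulmxA DB mul0mx scaler0 addr0.
Qed.

Lemma pt_inj n : (0 < n)%N -> injective (pt n).
Proof.
move=> n0 k k' /addrI /scalerI h.
have nn0 : n%:R^-1 != 0 :> R by rewrite invr_eq0 pnatr_eq0 -lt0n.
have {h} h : BR *m map_mx intr k = BR *m map_mx intr k' by exact: h.
have : map_mx intr k - map_mx intr k' = 0 :> 'cV[R]_r.
  by apply: B_inj; rewrite mulmxBr h subrr.
move=> /eqP; rewrite subr_eq0 => /eqP /matrixP e.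
by apply/matrixP => i j; apply: (@intr_inj R); have := e i j; rewrite !mxE.
Qed.

(** Multiplied by [n], the difference of two points of [X n] is an integer kernel vector, hence an
    integer combination of the columns of [B]. *)
Lemma pt_surj n x : (0 < n)%N -> X n x -> exists k, x = pt n k.
Proof.
move=> n0 [_ [z' z'E] Dx']; have [[_ [z zE] Dx0] _] := x0P n0.
have nn0 : n%:R != 0 :> R by rewrite pnatr_eq0 -lt0n.
have zz : map_mx intr (z' - z) = n%:R *: (x - x0 n) :> 'cV[R]_N.
  rewrite z'E zE -scalerBr scalerA divff // scale1r.
  by apply/matrixP => i j; rewrite !mxE intrB.
have /B_int [k kE] : D *m map_mx intr (z' - z) = 0 :> 'cV[R]_m.
  by rewrite zz -scalemxAr mulmxBr Dx' Dx0 subrr scaler0.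
exists k; rewrite /pt -map_mxM -kE zz scalerA mulVf // scale1r.
by rewrite addrC subrK.
Qed.

(** Compactness of [K] makes [X n] finite, so the sum over this set is an ordinary finite sum,
    transported along the bijection [pt n]. *)
Lemma lattice_sum n : (0 < n)%N -> exists s : seq 'cV[int]_r, [/\ uniq s,
  forall k, (k \in s) <-> K (pt n k) &
  \sum_(x \in X n) T n x = \sum_(k <- s) T n (pt n k)].
Proof.
move=> n0; pose P := [set k | K (pt n k)].
have PE : P = pt n @^-1` X n.
  by apply/seteqP; split=> k /=; [exact: pt_lattice|case].
have fP : finite_set P.
  rewrite PE; apply: finite_preimage; last exact: finite_lattice_points.
  by move=> a b _ _; exact: pt_inj.
have /finite_seqP [s sE] := fP.
have PE' : P = [set` undup s].
  by rewrite sE; apply/seteqP; split=> k /=; rewrite mem_undup.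
exists (undup s); split; first exact: undup_uniq.
  by move=> k; have -> : K (pt n k) = [set` undup s] k by rewrite -PE'.
rewrite (@reindex_fsbig _ _ _ _ _ (pt n) P (X n)).
  by rewrite PE' -fsbig_seq ?undup_uniq.
split=> [k|a b _ _|x Xx]; first exact: pt_lattice.
  exact: pt_inj.
have [k kE] := pt_surj n0 Xx; exists k => //.
by rewrite /P /= -kE; case: Xx.
Qed.

End Param.

Lemma psi_continuous : psi @ nbhs xhat --> psi xhat.
Proof.
move: (psiK1) => /(_ xhat).
by rewrite /continuous_at -(nbhs_subspace_interior (K1x : interior K1 xhat)).
Qed.

Lemma laplace_lattice_sum eta : 0 < eta -> \forall n \near \oo,
  `|\sum_(x \in X n) T n x - c n * expR (n%:R * phi xhat) *
      (Num.sqrt n%:R ^+ r * (psi xhat * gauss_cst M))|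
  <= eta * (c n * expR (n%:R * phi xhat) * Num.sqrt n%:R ^+ r).
Proof.
move=> eta0; have [x0 [t x0P]] := lattice_param.
pose pt n (k : 'cV[int]_r) := x0 n + n%:R^-1 *: (BR *m map_mx intr k).
have /boolp.choice [s sP] : forall n, exists s : seq 'cV[int]_r,
    uniq s /\ ((0 < n)%N -> (forall k, (k \in s) <-> K (pt n k)) /\
      \sum_(x \in X n) T n x = \sum_(k <- s) T n (pt n k)).
  move=> n; have [n0|] := boolP (0 < n)%N; last by exists [::].
  by have [s [us sK sT]] := lattice_sum x0P n0; exists s.
have us n : uniq (s n) by have [] := sP n.
have sK n k : (0 < n)%N -> (k \in s n) <-> K (pt n k).
  by move=> n0; have [_ /(_ n0) []] := sP n.
have sM : M^T = M by rewrite /M linearZ /= hessian_restr_sym.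
have pM : posdef M by exact: hessian_restr_posdef DB Kx Dx phi_max phiC2 detA.
pose Q n k := qform M (t n + n%:R^-1 *: map_mx intr k).
pose a n := c n * expR (n%:R * phi xhat).
have a0 n : (0 < n)%N -> 0 < a n by move=> n0; rewrite mulr_gt0 ?expR_gt0 ?c_gt0.
pose W n k := T n (pt n k) / a n.
have [kap kap0 kapP] := phi_global_bound DB cK phiK Kx Dx phi_max phiC2 detA.
have [eps epso [C0 C0P]] := T_bigO.
(* The constant of the bound on [T] may have any sign; [C] is a positive majorant. *)
pose C := `|C0| + 1; have C_gt0 : 0 < C by rewrite ltr_wpDl.
have near_sum e : 0 < e -> e <= 1 / 2 -> exists2 d, 0 < d &
    \forall n \near \oo, forall k, Q n k < d -> [/\ k \in s n,
     psi xhat * (1 - e) * expR (- (n%:R * (1 + e) * Q n k)) <= W n k &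
     W n k <= psi xhat * (1 + e) * expR (- (n%:R * (1 - e) * Q n k))].
  move=> e0 e12.
  have [d1 d10 d1P] := phi_expansion DB Kx Dx phi_max phiC2 detA e0.
  (* The relative error [e] is shared equally between the variation of [psi] and the error
     [delta]. *)
  have ep : 0 < e * psi xhat / 2 by rewrite divr_gt0 // mulr_gt0.
  have : \forall x \near xhat, K1 x /\ `|psi xhat - psi x| <= e * psi xhat / 2.
    near=> x; split; near: x; first exact: K1x.
    by move/cvgrPdist_le : psi_continuous; exact.
  move=> /nbhs_ballP [p /= p0 pP].
  have [d2 d20 d2P] := near_small DB Kx Dx phi_max phiC2 detA p0.
  exists (Num.min d1 d2); first by rewrite lt_min d10.
  have [delta deltao deltaP] := T_near.
  near=> n => k; rewrite lt_min => /andP [Q1 Q2].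
  have n0 : (0 < n)%N by near: n; exists 1%N.
  have nn0 : 0 <= n%:R :> R by [].
  have ptk := ptE x0P k n0; rewrite -/(pt n k) in ptk.
  have [K1k psik] : K1 (pt n k) /\ `|psi xhat - psi (pt n k)| <= e * psi xhat / 2.
    apply: pP; rewrite ptk -ball_normE /ball_ /= opprD addNKr normrN.
    exact: d2P.
  have Kk : K (pt n k) by exact: K1K.
  have Xk : X n (pt n k) by exact: (pt_lattice x0P).
  have dk : `|delta n (pt n k)| <= e * psi xhat / 2.
    have : forall x, (X n `&` K1) x -> `|delta n x| <= e * psi xhat / 2 * `|1 : R|.
      by near: n; exact: deltao.
    by move=> /(_ _ (conj Xk K1k)); rewrite normr1 mulr1.
  have TE : T n (pt n k) =
      c n * (psi (pt n k) + delta n (pt n k)) * expR (n%:R * phi (pt n k)).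
    have : forall x, X n x -> K1 x ->
        T n x = c n * (psi x + delta n x) * expR (n%:R * phi x).
      by near: n; exact: deltaP.
    exact.
  have WE : W n k = (psi (pt n k) + delta n (pt n k)) *
      expR (n%:R * (phi (pt n k) - phi xhat)).
    rewrite /W TE /a mulrBr expRB; field.
    by rewrite !gt_eqF ?expR_gt0 ?c_gt0.
  have := d1P _ Q1; rewrite -ptk -/(Q n k) ler_norml => /andP [f1 f2].
  move: psik dk; rewrite ler_distlC ler_norml => /andP [p1 p2] /andP [q1 q2].
  have psie : 0 < psi xhat * (1 - e) by rewrite mulr_gt0 //; lra.
  have lower : psi xhat * (1 - e) <= psi (pt n k) + delta n (pt n k) by lra.
  split; first by apply/sK.
    rewrite WE ler_pM ?expR_ge0 ?(ltW psie) // ler_expR -mulrA -mulrN ler_wpM2l //.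
    lra.
  rewrite WE ler_pM ?expR_ge0 ?(le_trans (ltW psie) lower) //; first lra.
  rewrite ler_expR -mulrA -mulrN ler_wpM2l //; lra.
have far_sum e : 0 < e -> \forall n \near \oo, forall k, k \in s n ->
    `|W n k| <= C * expR (- (n%:R * kap * Q n k) + e * n%:R).
  move=> e0; near=> n => k.
  have n0 : (0 < n)%N by near: n; exists 1%N.
  move=> /(sK _ _ n0) Kk; have Xk : X n (pt n k) by exact: (pt_lattice x0P).
  have bT : `|T n (pt n k)| <=
      C0 * `|c n * expR (n%:R * phi (pt n k) + eps n (pt n k))|.
    move: (pt n k) Xk => x Xx.
    have : forall x, X n x -> `|T n x| <= C0 * `|c n * expR (n%:R * phi x + eps n x)|.
      by near: n; exact: C0P.
    exact.
  have be : `|eps n (pt n k)| <= e * n%:R.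
    have : forall x, X n x -> `|eps n x| <= e * `|n%:R : R| by near: n; exact: epso.
    by move=> /(_ _ Xk); rewrite normr_nat.
  have Kt : K (xhat + BR *m (t n + n%:R^-1 *: map_mx intr k)).
    by rewrite -(ptE x0P).
  have := kapP _ Kt; rewrite -(ptE x0P) // -/(pt n k) -/(Q n k) => hphi.
  have cn := c_gt0 n0; have an := a0 n n0.
  rewrite /W normrM normfV (gtr0_norm an) ler_pdivrMr // (le_trans bT) //.
  rewrite (gtr0_norm (mulr_gt0 cn (expR_gt0 _))) /a.
  rewrite [leRHS](_ : _ = C * (c n * expR (- (n%:R * kap * Q n k) + e * n%:R +
    n%:R * phi xhat))); last by rewrite [in RHS]expRD; ring.
  apply: (@le_trans _ _
      (C * (c n * expR (n%:R * phi (pt n k) + eps n (pt n k))))).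
    rewrite ler_wpM2r ?mulr_ge0 ?expR_ge0 ?(ltW cn) //.
    by rewrite (le_trans (ler_norm C0)) // lerDl.
  rewrite ler_pM2l // ler_pM2l // ler_expR.
  have := ler_wpM2l (ler0n R n) hphi; have := le_trans (ler_norm _) be.
  rewrite -mulrA; lra.
have := laplace_sum sM pM us psi0 kap0 C_gt0 near_sum far_sum eta0.
apply: filter_app; near=> n.
have n0 : (0 < n)%N by near: n; exists 1%N.
have an := a0 n n0.
have -> : \sum_(x \in X n) T n x = a n * \sum_(k <- s n) W n k.
  have [_ /(_ n0) [_ ->]] := sP n; rewrite mulr_sumr; apply: eq_bigr => k _.
  by rewrite /W mulrC divfK // gt_eqF.
rewrite scale1r => h.
rewrite -/(a n) -mulrBr normrM (gtr0_norm an).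
by rewrite (_ : eta * _ = a n * (eta * Num.sqrt n%:R ^+ r)) ?ler_pM2l //; ring.
Unshelve. all: by end_near. Qed.

End Main.

(** * The value of the constant *)

Lemma sqrt_exprn (R : realType) (x : R) n : 0 <= x ->
  Num.sqrt (x ^+ n) = Num.sqrt x ^+ n.
Proof.
move=> x0; elim: n => [|n IH]; first by rewrite !expr0 sqrtr1.
by rewrite !exprS sqrtrM // IH.
Qed.

(** As [det A = tau * det_restr H V], the product of the two square roots on the right is
    [sqrt (det A)]; the factor [1 / 2] in the form turns [pi] into [2 pi]. *)
Lemma gauss_cst_restr (R : realType) (N r n : nat) (B : 'M[int]_(N, r))
    (H : 'M[R]_N) (V : {vspace 'cV[R]_N}) (tau : nat) (rho : R) :
  let BR := map_mx intr B : 'M[R]_(N, r) in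
  let A := BR^T *m H *m BR in
  \det (B^T *m B) = tau%:Z -> \det A / \det (BR^T *m BR) = det_restr H V ->
  det_restr H V != 0 -> A^T = A -> posdef (2^-1 *: A) ->
  Num.sqrt n%:R ^+ r * (rho * gauss_cst (2^-1 *: A)) =
  rho / (Num.sqrt tau%:R * Num.sqrt (det_restr H V)) * (2 * pi * n%:R) `^ (r%:R / 2).
Proof.
move=> BR A dB <-.
have -> : \det (BR^T *m BR) = tau%:R.
  by rewrite /BR map_trmx -map_mxM det_map_mx dB.
move=> d0 sA pA.
have sA' : (2^-1 *: A)^T = 2^-1 *: A by rewrite linearZ /= sA.
have := posdef_det_gt0 sA' pA; rewrite detZ pmulr_rgt0 ?exprn_gt0 ?invr_gt0 // => dA0.
have t0 : 0 <= tau%:R :> R by [].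
have twopi : 0 <= 2 * pi :> R by rewrite mulr_ge0 // pi_ge0.
(* If [tau] were 0, the quotient in [d0] would be 0 by the convention on division. *)
have t_gt0 : 0 < tau%:R :> R.
  rewrite lt_neqAle t0 andbT eq_sym; apply: contra d0 => /eqP tau0.
  by rewrite tau0 invr0 mulr0.
have -> : Num.sqrt tau%:R * Num.sqrt (\det A / tau%:R) = Num.sqrt (\det A).
  by rewrite -sqrtrM // mulrC divfK // gt_eqF.
have n0 : 0 <= n%:R :> R by [].
rewrite powRrM powR_mulrn ?mulr_ge0 ?pi_ge0 //.
rewrite powR12_sqrt ?exprn_ge0 ?mulr_ge0 ?pi_ge0 //.
rewrite exprMn sqrtrM ?exprn_ge0 // (sqrt_exprn _ n0) /gauss_cst detZ.
have -> : pi ^+ r / (2^-1 ^+ r * \det A) = (2 * pi) ^+ r * (\det A)^-1.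
  by rewrite invfM exprVn invrK exprMn; ring.
rewrite sqrtrM ?exprn_ge0 // sqrtrV ?(ltW dA0) //.
ring.
Qed.

Section KernelBasis.
Variables (R : realType) (m N r : nat) (D : 'M[R]_(m, N)) (B : 'M[R]_(N, r)).
Hypothesis DB : D *m B = 0.
Hypothesis B_span : forall x : 'cV[R]_N, D *m x = 0 -> exists t, x = B *m t.
Hypothesis B_inj : forall t : 'cV[R]_r, B *m t = 0 -> t = 0.

Lemma basis_of_kernel : basis_of (ker_cV D) [tuple col j B | j < r].
Proof.
have sumE (k : 'I_r -> R) : \sum_j k j *: [tuple col j B | j < r]`_j =
    B *m (\col_j k j).
  apply/matrixP => i l; rewrite (ord1 l) summxE mxE; apply: eq_bigr => j _.
  by rewrite mxE -tnth_nth tnth_mktuple !mxE mulrC.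
apply/andP; split; last first.
  apply/freeP => k; rewrite sumE => /B_inj /matrixP k0 i.
  by have := k0 i 0; rewrite !mxE.
rewrite eqEsubv; apply/andP; split.
  apply/span_subvP => x /tnthP [j ->].
  by rewrite tnth_mktuple mem_ker_cV colE mulmxA DB mul0mx.
apply/subvP => x; rewrite mem_ker_cV => /eqP /B_span [t ->].
have -> : t = \col_j t j 0 by apply/matrixP => i l; rewrite mxE (ord1 l).
rewrite -sumE; apply: rpred_sum => j _; apply/rpredZ/memv_span.
by rewrite -tnth_nth mem_tnth.
Qed.

End KernelBasis.

Theorem proposition3p4 (R : realType) (G : multigraph) (o : orientation G)
    (D : 'M[R]_(#|vertex G|, #|edge G|)) (r : nat)
    (y : 'cV[R]_#|vertex G|) (K K1 : set 'cV[R]_#|edge G|)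
    (phi psi : 'cV[R]_#|edge G| -> R) (xhat : 'cV[R]_#|edge G|)
    (c : nat -> R) (T : nat -> 'cV[R]_#|edge G| -> R) :
  let X := lattice_points K D y in
  let H := hessian phi xhat in
  (0 < #|vertex G|)%N ->
  has_cycle G ->
  (bipartite G /\ D = unsigned_incidence R o) \/
    (~ bipartite G /\ D = signed_incidence R o) ->
  \dim (ker_cV D) = r ->
  (exists x, D *m x = y) ->
  compact K ->
  convex_set (K : set (convex_lmodType 'cV[R]_#|edge G|)) ->
  interior K !=set0 ->
  {within K, continuous phi} ->
  interior K xhat ->
  D *m xhat = y ->
  (forall x, K x -> D *m x = y -> x <> xhat -> phi x < phi xhat) ->
  C2_near xhat phi ->
  nbhs xhat K1 ->
  K1 `<=` K ->
  {within K1, continuous psi} ->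
  0 < psi xhat ->
  (forall n, (0 < n)%N -> X n !=set0) ->
  (forall n, (0 < n)%N -> 0 < c n) ->
  (exists2 eps : nat -> 'cV[R]_#|edge G| -> R,
     uniform_littleo X eps (fun n => n%:R) &
     uniform_bigO X T (fun n x => c n * expR (n%:R * phi x + eps n x))) ->
  (exists2 delta : nat -> 'cV[R]_#|edge G| -> R,
     uniform_littleo (fun n => X n `&` K1) delta (fun=> 1) &
     \forall n \near \oo, forall x, X n x -> K1 x ->
       T n x = c n * (psi x + delta n x) * expR (n%:R * phi x)) ->
  det_restr (- H) (ker_cV D) != 0 ->
  (fun n => \sum_(x \in X n) T n x) ~_\oo
  (fun n => psi xhat
              / (Num.sqrt (tau G)%:R * Num.sqrt (det_restr (- H) (ker_cV D)))
              * (2 * pi * n%:R) `^ (r%:R / 2)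
              * c n * expR (n%:R * phi xhat)).
Proof.
move=> X H _ _ hD dimV _ cK _ _ phiK Kx Dx phi_max phiC2 K1x K1K psiK1 psi0.
move=> X_ne c_gt0 T_bigO T_near det0.
have hD' : (bipartite G /\ D = unsigned_incidence R o) \/ D = signed_incidence R o.
  by case: hD => [|[]]; [left|right].
have [B [DB B_span B_int B_inj dB]] := incidence_lattice_basis hD' dimV.
pose BR : 'M[R]_(#|edge G|, r) := map_mx intr B.
(* The restricted determinant is evaluated in the lattice basis, whose Gram determinant is
   [tau G]. *)
have dE : \det (BR^T *m - H *m BR) / \det (BR^T *m BR) = det_restr (- H) (ker_cV D).
  have bB := basis_of_kernel DB B_span B_inj.
  clear -bB dimV; subst r; rewrite (det_restrE _ bB).
  have -> : cols_mx [tuple col j (map_mx intr B) | j < \dim (ker_cV D)] = BR.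
    by apply/matrixP => i j; rewrite !mxE tnth_mktuple !mxE.
  by [].
have detA : \det (BR^T *m - H *m BR) != 0.
  by apply: contra det0 => /eqP h; rewrite -dE h mul0r.
have sA := hessian_restr_sym BR phiC2.
have pM := hessian_restr_posdef DB Kx Dx phi_max phiC2 detA.
have kE n := gauss_cst_restr n (psi xhat) dB dE det0 sA pM.
apply/eqaddoP => e e0.
have G0 : 0 < psi xhat * gauss_cst (2^-1 *: (BR^T *m - H *m BR)).
  rewrite mulr_gt0 // sqrtr_gt0 divr_gt0 ?exprn_gt0 ?pi_gt0 //.
  by apply: posdef_det_gt0 pM; rewrite linearZ /= sA.
(* The tolerance is [e] times the positive constant of [G0], which turns the bound into the relative
   error required by the equivalence. *)
have := laplace_lattice_sum DB B_span B_int B_inj cK phiK Kx Dx phi_max phiC2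
  K1x K1K psiK1 psi0 X_ne c_gt0 T_bigO T_near detA (mulr_gt0 e0 G0).
apply: filter_app; near=> n.
have n0 : (0 < n)%N by near: n; exists 1%N.
have cn := c_gt0 n n0.
rewrite [in X in _ -> `|X| <= _]/= => h.
have gE : psi xhat / (Num.sqrt (tau G)%:R * Num.sqrt (det_restr (- H) (ker_cV D)))
    * (2 * pi * n%:R) `^ (r%:R / 2) * c n * expR (n%:R * phi xhat) =
    c n * expR (n%:R * phi xhat) * (Num.sqrt n%:R ^+ r *
      (psi xhat * gauss_cst (2^-1 *: (BR^T *m - H *m BR)))).
  by rewrite kE; ring.
have a0 : 0 < c n * expR (n%:R * phi xhat) by rewrite mulr_gt0 ?expR_gt0.
have g0 := mulr_ge0 (ltW a0) (mulr_ge0 (exprn_ge0 r (sqrtr_ge0 n%:R)) (ltW G0)).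
rewrite !fctE gE (ger0_norm g0).
apply: (le_trans h); rewrite le_eqVlt; apply/orP; left; apply/eqP; ring.
Unshelve. all: by end_near. Qed.
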